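(* Let $\upsilon$ be an ordinal and let $\big((A_\tau,\Omega_\tau)_{\tau\le\upsilon},(\pi^*_{\sigma,\tau})_{\sigma\le\tau\le\upsilon}\big)$ be a system of Cole extensions of the natural uniform algebra $(A,\Omega)$ (each $(A_\tau,\Omega_\tau)$ being natural). Then for all $\tau\in[0,\upsilon]$, $$\pi^*_{0,\tau}\big(G(A)-e^{A}\big)\subseteq G(A_\tau)-e^{A_\tau}.$$ In particular, $H^1(\Omega_\tau,\mathbb{Z})=0$ implies that $H^1(\Omega,\mathbb{Z})=0$.
   Context: A uniform algebra $(A,X)$ is a supremum-norm-closed subalgebra of $C(X)$ ($X$ compact Hausdorff) separating the points of $X$ and containing the constants; it is natural if every character of $A$ is evaluation at a point of $X$. $G(A)$ is the group of invertible elements of $A$ and $e^{A}=\{e^a:a\in A\}$. $H^1(X,\mathbb{Z})$ is the first Čech cohomology group with integer coefficients. Cole extension: let $\mathcal{U}$ be a set of monic polynomials over $A$, $\alpha(x)=f^{(\alpha)}_0+\cdots+f^{(\alpha)}_{n(\alpha)-1}x^{n(\alpha)-1}+x^{n(\alpha)}$ for $\alpha\in\mathcal{U}$. Let $X^{\mathcal U}$ be the compact set of $(\kappa,\lambda)\in X\times\mathbb{C}^{\mathcal U}$ such that $f^{(\alpha)}_0(\kappa)+\cdots+f^{(\alpha)}_{n(\alpha)-1}(\kappa)\lambda_\alpha^{n(\alpha)-1}+\lambda_\alpha^{n(\alpha)}=0$ for all $\alpha\in\mathcal U$ (relative product topology), with $\pi:X^{\mathcal U}\to X$, $(\kappa,\lambda)\mapsto\kappa$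 and $p_\alpha:X^{\mathcal U}\to\mathbb{C}$, $(\kappa,\lambda)\mapsto\lambda_\alpha$. The Cole extension of $A$ by $\mathcal U$ is the uniform algebra $(A^{\mathcal U},X^{\mathcal U})$, where $A^{\mathcal U}$ is the closed subalgebra of $C(X^{\mathcal U})$ generated by $\{f\circ\pi:f\in A\}\cup\{p_\alpha:\alpha\in\mathcal U\}$. System of Cole extensions of $(A,\Omega)$: uniform algebras $(A_\tau,\Omega_\tau)_{\tau\le\upsilon}$ with continuous surjections $\pi_{\sigma,\tau}:\Omega_\tau\to\Omega_\sigma$ ($\sigma\le\tau\le\upsilon$), $\pi_{\sigma,\sigma}=\mathrm{id}$, $\pi_{\rho,\sigma}\circ\pi_{\sigma,\tau}=\pi_{\rho,\tau}$ for $\rho\le\sigma\le\tau$, and $\pi^*_{\sigma,\tau}(f)=f\circ\pi_{\sigma,\tau}$, such that: (i) $(A_0,\Omega_0)=(A,\Omega)$; (ii) if $\tau=\sigma+1$, there is a set $\mathcal U_\sigma$ of monic polynomials over $A_\sigma$ with $(A_\tau,\Omega_\tau)=(A_\sigma^{\mathcal U_\sigma},\Omega_\sigma^{\mathcal U_\sigma})$ and $\pi_{\sigma,\tau}$ the canonical projection; (iii) if $\tau>0$ is a limit ordinal, $\Omega_\tau$ (with the maps $\pi_{\sigma,\tau}$) is the inverse limit of $(\Omega_\sigma)_{\sigma<\tau}$ and $A_\tau$ is the closure in $C(\Omega_\tau)$ of $\bigcup_{\sigma<\tau}\pi^*_{\sigma,\tau}(A_\sigma)$. *)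

(* Defs.v *)
From HB Require Import structures.
From mathcomp Require Import all_boot all_order all_algebra.
From mathcomp Require Import generic_quotient complex.
From mathcomp Require Import all_classical all_reals all_analysis.
From mathcomp Require Import ring.

Set Implicit Arguments.
Unset Strict Implicit.
Unset Printing Implicit Defensive.

Import Order.TTheory GRing.Theory Num.Theory numFieldNormedType.Exports.

Local Open Scope classical_set_scope.
Local Open Scope ring_scope.

(** * Uniform algebras

    [R[i]^o] is the field of complex numbers carrying the topology of its
    norm.  An algebra of functions on [X] is a set [A : set (X -> R[i]^o)]. *)

Section UniformAlgebra.
Context {R : realType} {X : topologicalType}.
Implicit Type A : set (X -> R[i]^o).

(** [{uniform X -> _}] is the function space with the topology of uniform
    convergence, i.e. that of the supremum norm; [C(X)] is closed in it, so
    that closed subsets and closures may be taken there. *)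
Record closed_subalgebra A : Prop := {
  csa_continuous : forall f, A f -> continuous f;
  csa_zero : A (cst 0);
  csa_add : forall f g, A f -> A g -> A (f \+ g);
  csa_scale : forall (c : R[i]^o) f, A f -> A (fun x => c * f x);
  csa_mul : forall f g, A f -> A g -> A (f \* g);
  csa_closed : closed (A : set {uniform X -> R[i]^o}) }.

Record uniform_algebra A : Prop := {
  ua_compact : compact [set: X];
  ua_hausdorff : hausdorff_space X;
  ua_subalgebra : closed_subalgebra A;
  ua_cst : forall c, A (cst c);
  ua_separates : forall x y : X, x <> y -> exists2 f, A f & f x <> f y }.

(** Only the restriction of [phi] to [A] is relevant. *)
Record character A (phi : (X -> R[i]^o) -> R[i]^o) : Prop := {
  char_add : forall f g, A f -> A g -> phi (f \+ g) = phi f + phi g;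
  char_scale : forall (c : R[i]^o) f, A f -> phi (fun x => c * f x) = c * phi f;
  char_mul : forall f g, A f -> A g -> phi (f \* g) = phi f * phi g;
  char_neq0 : exists2 f, A f & phi f <> 0 }.

Definition natural A : Prop :=
  forall phi, character A phi -> exists x, forall f, A f -> phi f = f x.

Definition invertibles A : set (X -> R[i]^o) :=
  [set f | A f /\ exists2 g, A g & f \* g = cst 1].

Definition cexp (z : R[i]^o) : R[i]^o :=
  Complex (expR (complex.Re z) * cos (complex.Im z))
          (expR (complex.Re z) * sin (complex.Im z)).

Definition exponentials A : set (X -> R[i]^o) := [set cexp \o a | a in A].

End UniformAlgebra.

(** * Cole extensions *)

Section ColeExtension.
Context {R : realType} {X : topologicalType}.

(** [x ^ n + \sum_(i < n) f_i x ^ i], given by its degree and its non-leading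
    coefficients. *)
Record monic_poly := MonicPoly {
  mdeg : nat;
  mcoef : 'I_mdeg -> X -> R[i]^o }.

Definition monic_over (A : set (X -> R[i]^o)) (a : monic_poly) : Prop :=
  forall i, A (mcoef (m := a) i).

(** In degree 0 the polynomial is the constant 1, with no root; a system of Cole
    extensions excludes it by surjectivity of the projections, unless the space
    is empty. *)
Definition meval (a : monic_poly) (k : X) (l : R[i]^o) : R[i]^o :=
  \sum_(i < mdeg a) mcoef i k * l ^+ i + l ^+ mdeg a.

Variable U : set monic_poly.

Definition cole_set : set (X * {ptws U -> R[i]^o})%type :=
  [set q | forall a : U, meval (\val a) q.1 (q.2 a) = 0].

(** The coercion from sets to subtypes provides the relative topology. *)
Definition cole_space : topologicalType := cole_set.

Definition cole_proj (q : cole_space) : X := (\val q).1.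

Definition cole_root (a : U) (q : cole_space) : R[i]^o := (\val q).2 a.

Definition cole_algebra (A : set (X -> R[i]^o)) : set (cole_space -> R[i]^o) :=
  smallest closed_subalgebra
    ([set f \o cole_proj | f in A] `|` range cole_root).

End ColeExtension.
Arguments monic_poly : clear implicits.
Arguments cole_proj {R X} U q.
Arguments cole_algebra {R X} U A.

Definition homeomorphism (X Y : topologicalType) (h : X -> Y) : Prop :=
  continuous h /\ exists k : Y -> X, [/\ continuous k, cancel h k & cancel k h].

(** * Systems of Cole extensions

    The interval [[0, v]] of ordinals is represented by a well-ordered type
    [I] with a least element [\bot] and a greatest element: every such [I] is
    isomorphic, in a unique way, to [[0, v]] for exactly one ordinal [v].  That
    the order of [I] is a well-order is a separate hypothesis. *)

Section ColeSystem.
Context {R : realType} {d : Order.disp_t} {I : tbOrderType d}.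
Variable Om : I -> topologicalType.
Variable A : forall t, set (Om t -> R[i]^o).
Arguments A : clear implicits.
Variable pi : forall s t : I, (s <= t)%O -> Om t -> Om s.

Definition is_succ (s t : I) : Prop :=
  (s < t)%O /\ forall r, (s < r)%O -> (t <= r)%O.

Definition is_limit (t : I) : Prop :=
  (\bot < t)%O /\ forall s, ~ is_succ s t.

Definition is_cole_extension (s t : I) (st : (s <= t)%O) : Prop :=
  exists2 U : set (monic_poly R (Om s)), U `<=` monic_over (A s) &
  exists h : Om t -> cole_space U,
    [/\ homeomorphism h,
        forall x, cole_proj U (h x) = pi st x &
        A t = [set f \o h | f in cole_algebra U (A s)]].

Definition threads (t : I) :
    set (prod_topology (fun s : {s : I | (s < t)%O} => Om (sval s))) :=
  [set x | forall r s (rs : (sval r <= sval s)%O), pi rs (x s) = x r].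

Definition is_inverse_limit (t : I) : Prop :=
  exists h : Om t -> (@threads t : topologicalType), homeomorphism h /\
    forall x s, \val (h x) s = pi (ltW (svalP s)) x.

Definition pullbacks_below (t : I) : set (Om t -> R[i]^o) :=
  \bigcup_(s : {s : I | (s < t)%O})
    [set f \o pi (ltW (svalP s)) | f in A (sval s)].

(** A system of Cole extensions of [(A \bot, Om \bot)].  The equalities of
    spaces in the successor and limit clauses are homeomorphisms commuting with
    the structure maps. *)
Record cole_system : Prop := {
  cs_algebra : forall t, uniform_algebra (A t);
  cs_continuous : forall s t (st : (s <= t)%O), continuous (pi st);
  cs_surjective : forall s t (st : (s <= t)%O) x, exists y, pi st y = x;
  cs_id : forall s (ss : (s <= s)%O) x, pi ss x = x;
  cs_comp : forall r s t (rs : (r <= s)%O) (st : (s <= t)%O)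
      (rt : (r <= t)%O) x,
    pi rs (pi st x) = pi rt x;
  cs_succ : forall s t (st : (s <= t)%O), is_succ s t -> is_cole_extension st;
  cs_limit_space : forall t, is_limit t -> is_inverse_limit t;
  cs_limit_algebra : forall t, is_limit t ->
    A t = closure (@pullbacks_below t : set {uniform Om t -> R[i]^o}) }.

End ColeSystem.

(** * The first Čech cohomology group with integer coefficients

    It is the direct limit, over the open covers of [X] ordered by refinement,
    of the first simplicial cohomology groups of the nerves, computed with
    ordered cochains.  A cover is a set of open sets, and a 1-cochain is a
    function on pairs of sets whose only relevant values are those on pairs of
    members of the cover that meet. *)

Section Cech.
Variable X : topologicalType.
Implicit Types V W : set (set X).
Implicit Types c e : set X -> set X -> int.

Definition open_cover V : Prop :=
  (forall v, V v -> open v) /\ (forall x, exists2 v, V v & v x).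

Definition cocycle V c : Prop := forall u v w, V u -> V v -> V w ->
  u `&` v `&` w !=set0 -> c v w - c u w + c u v = 0.

Definition coboundary V c : Prop := exists b : set X -> int,
  forall u v, V u -> V v -> u `&` v !=set0 -> c u v = b v - b u.

Definition refines W V (r : set X -> set X) : Prop :=
  forall w, W w -> V (r w) /\ w `<=` r w.

Definition pull (r : set X -> set X) c : set X -> set X -> int :=
  fun u v => c (r u) (r v).

Record cech_cocycle := CechCocycle {
  cc_cover : set (set X);
  cc_fun : set X -> set X -> int;
  cc_coverP : open_cover cc_cover;
  cc_cocycleP : cocycle cc_cover cc_fun }.

HB.instance Definition _ := gen_eqMixin cech_cocycle.
HB.instance Definition _ := gen_choiceMixin cech_cocycle.

Implicit Types x y z : cech_cocycle.

(** Equality of the classes in the direct limit. *)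
Definition cech_eq x y : Prop := exists W r s,
  [/\ open_cover W, refines W (cc_cover x) r, refines W (cc_cover y) s &
      coboundary W (pull r (cc_fun x) - pull s (cc_fun y))].

(** [represents x W c]: [W] refines the cover of [x], and on the nerve of [W]
    the cochain [c] is cohomologous to the restriction of [x]. *)
Definition represents x W c : Prop := exists2 r, refines W (cc_cover x) r &
  coboundary W (pull r (cc_fun x) - c).

Lemma cochain_addE c e u v : (c + e) u v = c u v + e u v. Proof. by []. Qed.
Lemma cochain_oppE c u v : (- c) u v = - c u v. Proof. by []. Qed.
Lemma cochain_zeroE u v : (0 : set X -> set X -> int) u v = 0. Proof. by []. Qed.

Lemma coboundary_ext V c e : (forall u v, c u v = e u v) -> coboundary V c ->
  coboundary V e.
Proof. by move=> ce [b bP]; exists b => u v *; rewrite -ce bP. Qed.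

Lemma coboundaryD V c e : coboundary V c -> coboundary V e -> coboundary V (c + e).
Proof.
move=> [b bP] [b' b'P]; exists (fun v => b v + b' v) => u v Vu Vv uv.
rewrite cochain_addE bP // b'P //.
by ring.
Qed.

Lemma coboundaryN V c : coboundary V c -> coboundary V (- c).
Proof.
move=> [b bP]; exists (fun v => - b v) => u v Vu Vv uv.
by rewrite cochain_oppE bP // opprD.
Qed.

Lemma coboundary0 V : coboundary V 0.
Proof. by exists (fun=> 0) => u v _ _ _; rewrite cochain_zeroE subrr. Qed.

Lemma coboundary_refl V c : coboundary V (c - c).
Proof. by rewrite subrr; exact: coboundary0. Qed.

Lemma coboundary_pull V W r c : refines W V r -> coboundary V c ->
  coboundary W (pull r c).
Proof.
move=> rP [b bP]; exists (b \o r) => u v Wu Wv [p [up vp]].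
have [Vu su] := rP _ Wu; have [Vv sv] := rP _ Wv.
by apply: bP => //; exists p; split; [exact: su|exact: sv].
Qed.

Lemma cocycle_pull V W r c : refines W V r -> cocycle V c -> cocycle W (pull r c).
Proof.
move=> rP cP u v w Wu Wv Ww [p [[up vp] wp]].
have [Vu su] := rP _ Wu; have [Vv sv] := rP _ Wv; have [Vw sw] := rP _ Ww.
apply: cP => //; exists p; split; first split.
- exact: su.
- exact: sv.
- exact: sw.
Qed.

Lemma cocycleD V c e : cocycle V c -> cocycle V e -> cocycle V (c + e).
Proof.
move=> cP eP u v w Vu Vv Vw uvw.
have := cP _ _ _ Vu Vv Vw uvw; have := eP _ _ _ Vu Vv Vw uvw.
move=> e0 c0.
by rewrite !cochain_addE -[RHS]addr0 -[X in _ = X + _]c0 -e0; ring.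
Qed.

Lemma cocycleN V c : cocycle V c -> cocycle V (- c).
Proof.
move=> cP u v w Vu Vv Vw uvw; have c0 := cP _ _ _ Vu Vv Vw uvw.
by rewrite !cochain_oppE -oppr0 -c0; ring.
Qed.

Lemma cocycle0 V : cocycle V 0.
Proof. by move=> u v w _ _ _ _; rewrite !cochain_zeroE. Qed.

(** Two refinement maps induce the same map in cohomology. *)
Lemma refines_homotopic V W r s c : refines W V r -> refines W V s ->
  cocycle V c -> coboundary W (pull r c - pull s c).
Proof.
move=> rP sP cP; exists (fun w => - c (r w) (s w)) => u v Wu Wv [p [up vp]].
have [Vru ru] := rP _ Wu; have [Vsu su] := sP _ Wu.
have [Vrv rv] := rP _ Wv; have [Vsv sv] := sP _ Wv.
rewrite cochain_addE cochain_oppE /pull.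
have h1 : r u `&` r v `&` s v !=set0.
  by exists p; split; [split; [exact: ru|exact: rv]|exact: sv].
have h2 : r u `&` s u `&` s v !=set0.
  by exists p; split; [split; [exact: ru|exact: su]|exact: sv].
have := cP _ _ _ Vru Vrv Vsv h1; have := cP _ _ _ Vru Vsu Vsv h2.
move: (c (s u) (s v)) (c (r u) (s v)) (c (r u) (s u)) (c (r v) (s v)).
move=> a1 a2 a3 a4 e1 e2;
move: (c (r u) (r v)) e2 => a5 e2.
have -> : a5 - a1 = (a4 - a2 + a5) - (a1 - a2 + a3) + (- a4 + a3) by ring.
by rewrite e1 e2; ring.
Qed.

Lemma refines_comp V W W' r s : refines W V r -> refines W' W s ->
  refines W' V (r \o s).
Proof.
move=> rP sP w W'w; have [Ws ws] := sP _ W'w; have [Vr rs] := rP _ Ws.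
by split => //; apply: subset_trans rs.
Qed.

Definition cover_meet V W : set (set X) := [set v `&` w | v in V & w in W].

Lemma cover_meetP V W : open_cover V -> open_cover W -> open_cover (cover_meet V W).
Proof.
move=> [oV cV] [oW cW]; split=> [_ [v Vv [w Ww <-]]|p].
  by apply: openI; [exact: oV|exact: oW].
have [v Vv vp] := cV p; have [w Ww wp] := cW p.
by exists (v `&` w) => //; exists v => //; exists w.
Qed.

Lemma meet1_ex V W u : exists v, cover_meet V W u -> V v /\ u `<=` v.
Proof.
have [[v Vv [w Ww <-]]|nu] := pselect (cover_meet V W u); last by exists u.
by exists v => _; split => // p [].
Qed.

Lemma meet2_ex V W u : exists w, cover_meet V W u -> W w /\ u `<=` w.
Proof.
have [[v Vv [w Ww <-]]|nu] := pselect (cover_meet V W u); last by exists u.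
by exists w => _; split => // p [].
Qed.

Definition meet1 V W u : set X := sval (cid (meet1_ex V W u)).
Definition meet2 V W u : set X := sval (cid (meet2_ex V W u)).

Lemma meet1P V W : refines (cover_meet V W) V (meet1 V W).
Proof. by move=> u; rewrite /meet1; case: cid. Qed.

Lemma meet2P V W : refines (cover_meet V W) W (meet2 V W).
Proof. by move=> u; rewrite /meet2; case: cid. Qed.

Lemma represents_refl x : represents x (cc_cover x) (cc_fun x).
Proof.
by exists id; [split|exact: coboundary_refl].
Qed.

Lemma represents_pull x V W c r : refines W V r -> represents x V c ->
  represents x W (pull r c).
Proof.
move=> rP [s sP cP]; exists (s \o r); first exact: refines_comp rP.
exact: (coboundary_pull rP cP).
Qed.

Lemma represents_cob x V c e : represents x V c -> represents x V e ->
  coboundary V (c - e).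
Proof.
move=> [r rP cP] [s sP eP].
have h := refines_homotopic rP sP (@cc_cocycleP x).
apply: coboundary_ext (coboundaryD (coboundaryD (coboundaryN cP) h) eP) => u v.
by rewrite !(cochain_addE, cochain_oppE); ring.
Qed.

Lemma represents_eq x y W c e : open_cover W -> represents x W c ->
  represents y W e -> coboundary W (c - e) -> cech_eq x y.
Proof.
move=> oW [r rP cP] [s sP eP] ce; exists W, r, s; split => //.
apply: coboundary_ext (coboundaryD (coboundaryD cP ce) (coboundaryN eP)) => u v.
by rewrite !(cochain_addE, cochain_oppE); ring.
Qed.

Lemma eq_represents x y V W : cech_eq x y -> open_cover V -> open_cover W ->
  exists Z, [/\ open_cover Z, exists r, refines Z V r, exists r, refines Z W r &
   exists2 f, represents x Z f & represents y Z f].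
Proof.
move=> [Z [r [s [oZ rP sP rs]]]] oV oW.
set Z1 := cover_meet Z V; set Z2 := cover_meet Z1 W.
have p1 : refines Z2 Z1 (meet1 Z1 W) by exact: meet1P.
have p2 : refines Z1 Z (meet1 Z V) by exact: meet1P.
exists Z2; split.
- exact/cover_meetP/oW/cover_meetP.
- by exists (meet2 Z V \o meet1 Z1 W); exact: refines_comp (@meet2P _ _) p1.
- by exists (meet2 Z1 W); exact: meet2P.
exists (pull (meet1 Z1 W) (pull (meet1 Z V) (pull s (cc_fun y)))).
  by apply: represents_pull p1 (represents_pull p2 _); exists r.
apply: represents_pull p1 (represents_pull p2 _); exists s => //.
exact: coboundary_refl.
Qed.

Lemma represents2 x y : exists W c e,
  [/\ open_cover W, represents x W c & represents y W e].
Proof.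
exists (cover_meet (cc_cover x) (cc_cover y)).
exists (pull (meet1 (cc_cover x) (cc_cover y)) (cc_fun x)).
exists (pull (meet2 (cc_cover x) (cc_cover y)) (cc_fun y)); split.
- exact: cover_meetP (@cc_coverP x) (@cc_coverP y).
- exact: (represents_pull (@meet1P _ _) (represents_refl x)).
- exact: (represents_pull (@meet2P _ _) (represents_refl y)).
Qed.

Lemma represents3 x y z : exists W c e f,
  [/\ open_cover W, represents x W c, represents y W e & represents z W f].
Proof.
have [W [c [e [oW xc ye]]]] := represents2 x y.
pose m1 := meet1 W (cc_cover z); pose m2 := meet2 W (cc_cover z).
exists (cover_meet W (cc_cover z)), (pull m1 c), (pull m1 e), (pull m2 (cc_fun z)).
split.
- exact: cover_meetP oW (@cc_coverP z).
- exact: (represents_pull (@meet1P _ _) xc).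
- exact: (represents_pull (@meet1P _ _) ye).
- exact: (represents_pull (@meet2P _ _) (represents_refl z)).
Qed.

Lemma cech_eq_refl x : cech_eq x x.
Proof.
apply: (represents_eq (@cc_coverP x) (represents_refl x) (represents_refl x)).
exact: coboundary_refl.
Qed.

Lemma cech_eq_sym x y : cech_eq x y -> cech_eq y x.
Proof.
move=> [W [r [s [oW rP sP /coboundaryN]]]]; rewrite opprB => rs.
by exists W, s, r.
Qed.

Lemma cech_eq_trans y x z : cech_eq x y -> cech_eq y z -> cech_eq x z.
Proof.
move=> xy yz; have oX := @cc_coverP x.
have [V [oV _ _ [f xf yf]]] := eq_represents xy oX oX.
have [W [oW [r rP] _ [g yg zg]]] := eq_represents yz oV oV.
apply: (represents_eq oW (represents_pull rP xf) zg).
exact: represents_cob (represents_pull rP yf) yg.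
Qed.

Definition cech_eqb : rel cech_cocycle := fun x y => `[< cech_eq x y >].

Lemma cech_eqb_refl : reflexive cech_eqb.
Proof. by move=> x; apply/asboolP; exact: cech_eq_refl. Qed.

Lemma cech_eqb_sym : symmetric cech_eqb.
Proof. by move=> x y; apply/asboolP/asboolP; exact: cech_eq_sym. Qed.

Lemma cech_eqb_trans : transitive cech_eqb.
Proof.
by move=> y x z /asboolP xy /asboolP yz; apply/asboolP; exact: cech_eq_trans yz.
Qed.

Canonical cech_equiv :=
  EquivRel cech_eqb cech_eqb_refl cech_eqb_sym cech_eqb_trans.

Definition cech_H1 : Type := {eq_quot cech_equiv}%qT.

HB.instance Definition _ := EqQuotient.on cech_H1.
HB.instance Definition _ := Choice.on cech_H1.

Local Open Scope quotient_scope.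

Definition cech_class x : cech_H1 := \pi_cech_H1 x.

Lemma cech_classP x y : cech_class x = cech_class y <-> cech_eq x y.
Proof.
split; first by move/eqmodP/asboolP.
by move=> xy; apply/eqmodP/asboolP.
Qed.

Lemma open_cover_setT : open_cover [set [set: X]].
Proof. by split=> [_ ->|p]; [exact: openT|exists setT]. Qed.

Definition cocycle_zero : cech_cocycle := CechCocycle open_cover_setT (@cocycle0 _).

Definition cocycle_opp x : cech_cocycle :=
  CechCocycle (@cc_coverP x) (cocycleN (@cc_cocycleP x)).

Definition cocycle_add x y : cech_cocycle :=
  CechCocycle (cover_meetP (@cc_coverP x) (@cc_coverP y))
    (cocycleD (cocycle_pull (@meet1P _ _) (@cc_cocycleP x))
              (cocycle_pull (@meet2P _ _) (@cc_cocycleP y))).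

Lemma represents_zero W : represents cocycle_zero W 0.
Proof. by exists (fun=> setT); [split|exact: coboundary_refl]. Qed.

Lemma represents_opp x W c : represents x W c -> represents (cocycle_opp x) W (- c).
Proof.
move=> [r rP /coboundaryN cP]; exists r => //.
by move: cP; rewrite opprB addrC opprK.
Qed.

Lemma represents_add x y W c e : represents x W c -> represents y W e ->
  represents (cocycle_add x y) W (c + e).
Proof.
move=> [r rP cP] [s sP eP].
set V1 := cc_cover x; set V2 := cc_cover y.
pose t w := r w `&` s w.
have tP : refines W (cover_meet V1 V2) t.
  move=> w Ww; have [Vr wr] := rP _ Ww; have [Vs ws] := sP _ Ww.
  split; first by exists (r w) => //; exists (s w).
  by move=> p wp; split; [exact: wr|exact: ws].
exists t => //.
have h1 := refines_homotopic (refines_comp (@meet1P V1 V2) tP) rP (@cc_cocycleP x).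
have h2 := refines_homotopic (refines_comp (@meet2P V1 V2) tP) sP (@cc_cocycleP y).
apply: coboundary_ext (coboundaryD (coboundaryD h1 cP) (coboundaryD h2 eP)) => u v.
by rewrite !(cochain_addE, cochain_oppE) /pull /= !(cochain_addE, cochain_oppE); ring.
Qed.

Definition H1_zero : cech_H1 := cech_class cocycle_zero.
Definition H1_opp (a : cech_H1) : cech_H1 := cech_class (cocycle_opp (repr a)).
Definition H1_add (a b : cech_H1) : cech_H1 :=
  cech_class (cocycle_add (repr a) (repr b)).

Lemma cech_classK (a : cech_H1) : cech_class (repr a) = a.
Proof. exact: reprK. Qed.

Lemma repr_cech_class x : cech_eq (repr (cech_class x)) x.
Proof. by apply/cech_classP; rewrite cech_classK. Qed.

Lemma cech_class_eq x y W c : open_cover W -> represents x W c -> represents y W c ->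
  cech_class x = cech_class y.
Proof.
by move=> oW xc yc; apply/cech_classP/(represents_eq oW xc yc); exact: coboundary_refl.
Qed.

Lemma H1_oppE x : H1_opp (cech_class x) = cech_class (cocycle_opp x).
Proof.
have oX := @cc_coverP x.
have [W [oW _ _ [f f1 f2]]] := eq_represents (repr_cech_class x) oX oX.
exact: cech_class_eq oW (represents_opp f1) (represents_opp f2).
Qed.

Lemma H1_addE x y :
  H1_add (cech_class x) (cech_class y) = cech_class (cocycle_add x y).
Proof.
have oX := @cc_coverP x.
have [W [oW _ _ [f f1 f2]]] := eq_represents (repr_cech_class x) oX oX.
have [Z [oZ [r rP] _ [g g1 g2]]] := eq_represents (repr_cech_class y) oW oW.
apply: (cech_class_eq oZ); first exact: represents_add (represents_pull rP f1) g1.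
exact: represents_add (represents_pull rP f2) g2.
Qed.

Lemma H1_addA : associative H1_add.
Proof.
move=> a b c; rewrite -(cech_classK a) -(cech_classK b) -(cech_classK c) !H1_addE.
have [W [ca [cb [cg [oW ra rb rc]]]]] := represents3 (repr a) (repr b) (repr c).
apply: (cech_class_eq oW); first exact: represents_add ra (represents_add rb rc).
by rewrite addrA; exact: represents_add (represents_add ra rb) rc.
Qed.

Lemma H1_addC : commutative H1_add.
Proof.
move=> a b; rewrite -(cech_classK a) -(cech_classK b) !H1_addE.
have [W [ca [cb [oW ra rb]]]] := represents2 (repr a) (repr b).
apply: (cech_class_eq oW); first exact: represents_add ra rb.
by rewrite addrC; exact: represents_add rb ra.
Qed.

Lemma H1_add0 : left_id H1_zero H1_add.
Proof.
move=> a; rewrite -(cech_classK a) H1_addE.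
apply: (cech_class_eq (@cc_coverP (repr a)) _ (represents_refl _)).
rewrite -[X in represents _ _ X]add0r.
exact: represents_add (represents_zero _) (represents_refl _).
Qed.

Lemma H1_addN : left_inverse H1_zero H1_opp H1_add.
Proof.
move=> a; rewrite -(cech_classK a) H1_oppE H1_addE.
apply: (cech_class_eq (@cc_coverP (repr a)) _ (represents_zero _)).
rewrite -(addNr (cc_fun (repr a))).
exact: represents_add (represents_opp (represents_refl _)) (represents_refl _).
Qed.

HB.instance Definition _ :=
  GRing.isZmodule.Build cech_H1 H1_addA H1_addC H1_add0 H1_addN.

End Cech.

(* Main.v *)
Require Import Defs.
From mathcomp Require Import all_boot all_order all_algebra complex.
From mathcomp Require Import all_classical wochoice all_reals all_analysis.
From mathcomp Require Import ring lra zify.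
Import Order.TTheory GRing.Theory Num.Theory numFieldNormedType.Exports.
Import Normc.
Set Implicit Arguments.
Unset Strict Implicit.
Unset Printing Implicit Defensive.
Local Open Scope classical_set_scope.
Local Open Scope ring_scope.

(** Logarithms descend along Cole extensions, by averaging over the roots.

    Consider one monic polynomial of degree [n] over [A], the extension
    [p : Y -> X], and suppose that [f \o p = exp g] with [g] in the extended
    algebra.  The sum [S g] of [g] over the [n] roots, counted with
    multiplicity, is a function on [X] and [f ^ n = exp (S g)].  It belongs
    to [A] because the power sums of the roots are polynomials in the
    coefficients (Newton).  Hence [f * exp (- S g / n)] is an element of [A]
    with values in the [n]-th roots of unity; it takes finitely many values,
    so a polynomial in it is a logarithm, and [f] is in [exp A]
    ([averaged_log]).

    For infinitely many polynomials, or at a limit ordinal, the algebra is the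
    closure of a directed union of closed subalgebras.  A logarithm [g] of [f]
    close to a subalgebra [B] that contains [f] lies in [B], by Newton's
    method for [exp g = f] started in [B] ([us_log_near]); so [g] already
    lies in one of the subalgebras of the union.  In a Cole extension these
    are the algebras generated by finitely many roots, from which the roots
    are removed one at a time ([tower_log], [cole_descent]).  Transfinite
    induction ([transfinite_descent]) yields the first claim.

    The second claim is the same descent for the algebras of all continuous
    functions, together with the correspondence between [H^1(X, Z)] and the
    classes of nonvanishing continuous functions modulo exponentials.  The
    spaces are compact and [exp g] is constant on the fibres, so [g] can only
    jump by multiples of [2 pi i] on them: by compactness it depends on
    finitely many roots, or at a limit on an earlier space
    ([compact_directed_oscillation]).  The sum of a continuous function over
    the roots is continuous ([sheet_sum_continuous]), and the averaging
    argument applies again ([cole_descent_continuous]).  Finally a cocycle on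
    the base is the coboundary of real functions [h_v], by a partition of
    unity.  The functions [exp (2 pi i h_v)] glue to a function [f] on the
    base, whose pullback has a logarithm as soon as the pulled back cocycle is
    a coboundary; then [f] has a logarithm itself, and its differences with
    the [2 pi i h_v] show that the original cocycle is a coboundary on a
    refinement ([cech_H1_descent]). *)

(** * The complex exponential *)

Section ComplexExponential.
Context {R : realType}.
Implicit Types (z w : R[i]^o).

Lemma normcE (z : R[i]) : `|z| = (normc z)%:C%C.
Proof. by []. Qed.

Lemma normc_ge0 (z : R[i]) : 0 <= normc z.
Proof. by case: z => a b; exact: sqrtr_ge0. Qed.

Lemma normc_real (a : R) : normc (a%:C%C) = `|a|.
Proof. by rewrite /normc /= expr0n addr0 sqrtr_sqr. Qed.

Lemma Re_le_normc (z : R[i]) : `|complex.Re z| <= normc z.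
Proof. by have := normc_ge_Re z; rewrite normcE lecR. Qed.

Lemma Im_le_normc (z : R[i]) : `|complex.Im z| <= normc z.
Proof.
case: z => a b /=; rewrite -sqrtr_sqr ler_wsqrtr //.
by rewrite lerDr sqr_ge0.
Qed.

Lemma normc_le_ReIm (z : R[i]) : normc z <= `|complex.Re z| + `|complex.Im z|.
Proof.
case: z => a b /=; rewrite -[leRHS]ger0_norm ?addr_ge0 // -sqrtr_sqr ler_wsqrtr //.
by rewrite sqrrD !real_normK ?num_real // lerD2r lerDl mulrn_wge0 // mulr_ge0.
Qed.

Lemma normcX (z : R[i]) n : normc (z ^+ n) = normc z ^+ n.
Proof.
elim: n => [|n IH]; first by rewrite !expr0 normc1.
by rewrite !exprS normcM IH.
Qed.

Lemma deriv_littleo (f : R -> R) df : is_derive (0 : R) (1 : R) f df ->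
  forall e : R, 0 < e ->
  exists2 d : R, 0 < d & forall h, `|h| < d -> `|f h - f 0 - df * h| <= e * `|h|.
Proof.
move=> [fd <-] e e0.
have /cvgrPdist_le /(_ _ e0) :
    h^-1 *: ((f \o shift 0) (h *: 1) - f 0) @[h --> 0^'] --> 'D_1 f 0.
  exact: fd.
rewrite near_withinE /= => /nbhs_ballP[d /= d0 H].
exists d => // h hd.
have [->|h0] := eqVneq h 0; first by rewrite subrr mulr0 subrr normr0 mulr0.
have : ball (0 : R) d h by rewrite /ball/= sub0r normrN.
move=> /H /(_ h0) /=.
rewrite addr0 => {}H; rewrite -ler_pdivrMr ?normr_gt0 // -normfV -normrM.
rewrite -normrN; apply: le_trans H; rewrite le_eqVlt; apply/orP; left; apply/eqP.
congr (`| _ |); rewrite /GRing.scale /= mulr1; by field.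
Qed.

Lemma cexpD z w : cexp (z + w) = cexp z * cexp w.
Proof.
case: z w => [a b] [c d]; rewrite /cexp /= expRD cosD sinD.
by apply/eqP; rewrite eq_complex /=; apply/andP; split; apply/eqP; ring.
Qed.

Lemma cexp0 : cexp 0 = 1 :> R[i]^o.
Proof. by rewrite /cexp /= expR0 cos0 sin0 mul1r mul1r. Qed.

Lemma cexp_unit z : cexp z * cexp (- z) = 1.
Proof. by rewrite -cexpD subrr cexp0. Qed.

Lemma cexp_neq0 z : cexp z != 0.
Proof.
by apply/eqP => z0; have /eqP := cexp_unit z; rewrite z0 mul0r eq_sym oner_eq0.
Qed.

Lemma cexpN z : cexp (- z) = (cexp z)^-1.
Proof. by apply: (mulfI (cexp_neq0 z)); rewrite cexp_unit divff // cexp_neq0. Qed.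

Lemma cexpMn z n : cexp (z *+ n) = cexp z ^+ n.
Proof.
elim: n => [|n IH]; first by rewrite mulr0n expr0 cexp0.
by rewrite mulrS exprS cexpD IH.
Qed.

Lemma normc_cexp z : normc (cexp z) = expR (complex.Re z).
Proof.
case: z => a b; rewrite /cexp /= !exprMn -mulrDr cos2Dsin2 mulr1.
by rewrite sqrtr_sqr ger0_norm ?expR_ge0.
Qed.

(** First order expansion at the origin.  By [cexpD] it controls the exponential
    near every point, so that no power series enters the estimates below. *)
Lemma cexp_littleo (e : R) : 0 < e ->
  exists2 d : R, 0 < d & forall w, normc w < d ->
    normc (cexp w - 1 - w) <= e * normc w.
Proof.
move=> e0.
(* The errors below add up to [4 * k] for the real part and [5 * k] for the
   imaginary part. *)
pose k := Num.min 1 (e / 9).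
have k0 : 0 < k by rewrite lt_min ltr01 /= divr_gt0.
have k1 : k <= 1 by rewrite /k ge_min lexx.
have ke : 9 * k <= e.
  have : k <= e / 9 by rewrite /k ge_min lexx orbT.
  lra.
clearbody k.
have [d1 d10 H1] := @deriv_littleo expR (expR 0) (is_derive_expR 0) _ k0.
have [d2 d20 H2] := @deriv_littleo sin (cos 0) (is_derive_sin 0) _ k0.
have [d3 d30 H3] := @deriv_littleo cos (- sin 0) (is_derive_cos 0) _ k0.
exists (Num.min (Num.min d1 d2) (Num.min d3 k)).
  by rewrite !lt_min d10 d20 d30 k0.
case=> a b; rewrite !lt_min => /andP[/andP[w1 w2] /andP[w3 wk]].
have wa := Re_le_normc (a +i* b)%C; have wb := Im_le_normc (a +i* b)%C.
move: w1 w2 w3 wk wa wb; set m := normc _ => w1 w2 w3 wk wa wb.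
have {}H1 := H1 a (le_lt_trans wa w1).
have {}H2 := H2 b (le_lt_trans wb w2).
have {}H3 := H3 b (le_lt_trans wb w3).
apply: le_trans (normc_le_ReIm _) _.
rewrite /= in H1 H2 H3 wa wb *.
move: H1 H2 H3; rewrite expR0 sin0 cos0 subr0 oppr0 mul0r subr0 !mul1r.
move: (expR a) (cos b) (sin b) => E c s H1 H2 H3.
have E2 : `|E - 1| <= 2 * `|a|.
  have -> : E - 1 = (E - 1 - a) + a by ring.
  apply: le_trans (ler_normD _ _) _; have := normr_ge0 a; nra.
have E3 : `|E| <= 3.
  have -> : E = (E - 1) + 1 by ring.
  apply: le_trans (ler_normD _ _) _; rewrite normr1; lra.
have s2 : `|s| <= 2 * `|b|.
  have -> : s = (s - b) + b by ring.
  apply: le_trans (ler_normD _ _) _; have := normr_ge0 b; nra.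
have r1 : `|E * c - 1 - a| <= k * m + 3 * (k * m).
  have -> : E * c - 1 - a = (E - 1 - a) + E * (c - 1) by ring.
  apply: le_trans (ler_normD _ _) _; rewrite normrM.
  have := normr_ge0 a; have := normr_ge0 E; have := normr_ge0 b.
  have := normr_ge0 (c - 1) => *; apply: lerD; nra.
have r2 : `|E * s - 0 - b| <= 4 * (k * m) + k * m.
  have -> : E * s - 0 - b = (E - 1) * s + (s - b) by ring.
  apply: le_trans (ler_normD _ _) _; rewrite normrM.
  have := normr_ge0 a; have := normr_ge0 (E - 1); have := normr_ge0 b.
  have := normr_ge0 s => *; apply: lerD; last by nra.
  have : `|E - 1| * `|s| <= (2 * `|a|) * (2 * `|b|) by apply: ler_pM.
  move=> h; apply: le_trans h _.
  have : `|a| * `|b| <= k * m by apply: ler_pM => //; lra.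
  lra.
have m0 : 0 <= m by exact: normc_ge0.
move: r1 r2; rewrite /= => r1 r2.
have : 9 * k * m <= e * m by rewrite ler_wpM2r.
by move: r2; rewrite subr0 addr0; lra.
Qed.

Lemma cexp_eq1 z : cexp z = 1 -> exists k : int, z = Complex 0 (2 * pi * k%:~R).
Proof.
case: z => a b /eqP; rewrite eq_complex /cexp /= => /andP[/eqP h1 /eqP h2].
have s0 : sin b = 0.
  by move/eqP: h2; rewrite mulf_eq0 expR_eq0 /= => /eqP.
have c1 : cos b = 1.
  have := sin0cos1 s0; have : 0 < cos b.
    by move: (expR_gt0 a) => ea; rewrite -(pmulr_rgt0 _ ea) h1.
  by move=> c0; rewrite gtr0_norm.
have ea : a = 0 by apply/expR_inj; rewrite expR0 -h1 c1 mulr1.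
(* Reduce the angle to [[0, 2 pi[], where the cosine equals 1 only at 0. *)
exists (Num.floor (b / (2 * pi))); rewrite ea; congr Complex.
set k := Num.floor _.
have pi0 : 0 < 2 * pi :> R by rewrite mulr_gt0 // pi_gt0.
pose x := b - 2 * pi * k%:~R.
have x0 : 0 <= x.
  rewrite /x subr_ge0 mulrC -ler_pdivlMr //; by have /andP[] := floor_itv (b / (2 * pi)).
have x2 : x < 2 * pi.
  have := floorD1_gt (b / (2 * pi)); rewrite -/k ltr_pdivrMr // intrD.
  by rewrite /x; lra.
suff : x = 0 by rewrite /x; lra.
have per (j : int) : cos (b + 2 * pi * j%:~R) = 1 /\ sin (b + 2 * pi * j%:~R) = 0.
  have h (n : nat) (y : R) : cos (y + 2 * pi * n%:R) = cos y /\
      sin (y + 2 * pi * n%:R) = sin y.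
    have -> : 2 * pi * n%:R = (pi *+ 2) *+ n :> R.
      by rewrite -[_ *+ n]mulr_natl -[pi *+ 2]mulr_natl; ring.
    by rewrite (periodicn (@cosD2pi R)) (periodicn (@sinD2pi R)).
  case: j => n; first by have [-> ->] := h n b.
  have [+ +] := h n.+1 (b + 2 * pi * (Negz n)%:~R).
  by rewrite NegzE mulrNz mulrN subrK => <- <-.
have [cx sx] : cos x = 1 /\ sin x = 0.
  by have := per (- k); rewrite mulrNz mulrN.
have xpi (y : R) : 0 <= y <= pi -> cos y = 1 -> y = 0.
  move=> yb cy; apply: cos_inj; rewrite ?cos0 // in_itv /= ?lexx ?pi_ge0 //.
have [xle|xgt] := leP x pi; first by apply: xpi => //; rewrite x0.
have : 2 * pi - x = 0.
  apply: xpi; first by apply/andP; split; lra.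
  by rewrite cosB cx sx mulr1 mulr0 addr0 mulr_natl cos2pi.
by lra.
Qed.

Lemma cexp_2pi (k : int) : cexp (Complex 0 (2 * pi * k%:~R) : R[i]^o) = 1.
Proof.
have h (n : nat) : cexp (Complex 0 (2 * pi * n%:R) : R[i]^o) = 1.
  have -> : Complex 0 (2 * pi * n%:R) = (Complex 0 (pi *+ 2) : R[i]^o) *+ n.
    elim: n => [|n IH]; first by rewrite mulr0.
    rewrite [RHS]mulrS -IH; apply/eqP; rewrite eq_complex /= addr0 eqxx /=.
    by apply/eqP; rewrite -natr1 -[pi *+ 2]mulr_natl; ring.
  rewrite cexpMn /cexp /= expR0 cos2pi sin2pi !mul1r.
  by rewrite -[Complex _ _]/(1 : R[i]) expr1n.
case: k => n; first exact: h.
have -> : Complex 0 (2 * pi * (Negz n)%:~R) = - Complex 0 (2 * pi * n.+1%:R) :> R[i]^o.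
  by apply/eqP; rewrite eq_complex /= oppr0 eqxx NegzE mulrNz mulrN /=.
by rewrite cexpN h invr1.
Qed.

End ComplexExponential.

Section ExpEstimates.
Context {R : realType}.
Implicit Types z w : R[i]^o.

Lemma normc_distC z w : normc (z - w) = normc (w - z).
Proof. by rewrite -normcN opprB. Qed.

Lemma normc_subX_le z w (K : R) n : 1 <= K -> normc z <= K -> normc w <= K ->
  normc (z ^+ n - w ^+ n) <= n%:R * K ^+ n * normc (z - w).
Proof.
move=> K1 zK wK; elim: n => [|n IH]; first by rewrite subrr normc0 !mul0r.
have -> : z ^+ n.+1 - w ^+ n.+1 = z * (z ^+ n - w ^+ n) + w ^+ n * (z - w).
  by rewrite !exprS; ring.
apply: le_trans (le_normcD _ _) _; rewrite !normcM normcX.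
have D0 := normc_ge0 (z - w); have K0 : 0 <= K by lra.
rewrite -natr1 !mulrDl mul1r; apply: lerD.
  apply: le_trans (ler_pM (normc_ge0 _) (normc_ge0 _) zK IH) _.
  by rewrite exprS le_eqVlt; apply/orP; left; apply/eqP; ring.
apply: ler_wpM2r => //; apply: le_trans (_ : K ^+ n <= _).
  by apply: lerXn2r; rewrite ?nnegrE ?normc_ge0.
by rewrite exprS ler_peMl ?exprn_ge0.
Qed.

Lemma cexp_near : exists2 c : R, 0 < c & forall w, normc w < c ->
  normc (cexp w - 1 - w) <= 2^-1 * normc w.
Proof. by apply: cexp_littleo; rewrite invr_gt0 ltr0n. Qed.

(** By the first order expansion, a small [w] with [cexp w = 1] is at most half
    as large as itself. *)
Lemma cexp_inj_near : exists2 c : R, 0 < c & forall z w, normc (z - w) < c ->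
  cexp z = cexp w -> z = w.
Proof.
have [c c0 H] := cexp_near; exists c => // z w zw e.
have := H _ zw; rewrite cexpD e cexp_unit subrr sub0r normcN.
have := normc_ge0 (z - w) => h1 h2.
by apply/eqP; rewrite -subr_eq0; apply/eqP/eq0_normc; lra.
Qed.

(** The exponential is a limit of polynomials, uniformly on bounded sets: the
    exponential of [z / n] differs from [1 + z / n] by [o (1 / n)], and raising
    to the power [n] multiplies this error by at most [n * expR M]. *)
Lemma cexp_powers (M e : R) : 0 < M -> 0 < e -> exists n : nat,
  forall z, normc z <= M -> normc (cexp z - (1 + n.+1%:R^-1 * z) ^+ n.+1) < e.
Proof.
move=> M0 e0.
pose k := e / (2 * (M * expR M)).
have P0 : 0 < M * expR M by rewrite mulr_gt0 ?expR_gt0.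
have k0 : 0 < k by apply: divr_gt0 => //; apply: mulr_gt0 => //; rewrite ltr0n.
have [d d0 H] := cexp_littleo k0.
have [n nP] : exists n : nat, M / d < n.+1%:R.
  by exists (Num.truncn (M / d)); rewrite truncnS_gt.
exists n => z zM.
set N : R := n.+1%:R; have N0 : 0 < N by rewrite ltr0n.
set w := n.+1%:R^-1 * z.
have wE : normc w = normc z / N.
  rewrite normcM mulrC; congr (_ * _).
  by rewrite -[n.+1%:R]/(n.+1%:R : R[i]) -(rmorph_nat (real_complex R)) -fmorphV normc_real
    ger0_norm // invr_ge0 ltW.
have wM : normc w <= M / N by rewrite wE ler_pM2r ?invr_gt0.
have wd : normc w < d.
  by apply: le_lt_trans wM _; rewrite ltr_pdivrMr // mulrC -ltr_pdivrMr.
have zw : z = w *+ n.+1.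
  by rewrite -mulr_natl /w mulrA divff ?mul1r // pnatr_eq0.
rewrite {1}zw cexpMn.
have w0 := normc_ge0 w.
set K := expR (M / N).
have K1 : 1 <= K.
  by rewrite -expR0 ler_expR divr_ge0 // ltW.
have h1 : normc (cexp w) <= K.
  rewrite normc_cexp ler_expR; apply: le_trans wM.
  exact: le_trans (ler_norm _) (Re_le_normc _).
have h2 : normc (1 + w) <= K.
  apply: le_trans (le_normcD _ _) _; rewrite normc1.
  by apply: le_trans (expR_ge1Dx _) _; rewrite ler_expR.
apply: (le_lt_trans (normc_subX_le n.+1 K1 h1 h2)).
rewrite -/N -expRM_natl -/N mulrC.
have -> : N * (M / N) = M by field; rewrite gt_eqF.
have : normc (cexp w - (1 + w)) <= k * (M / N).
  rewrite opprD addrA; apply: le_trans (H _ wd) _.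
  by rewrite ler_pM2l.
move=> h3; apply: le_lt_trans (ler_wpM2r _ h3) _.
  by rewrite mulr_ge0 ?expR_ge0 // ltW.
have -> : k * (M / N) * (N * expR M) = e / 2.
  by rewrite /k; field; rewrite !gt_eqF // expR_gt0.
by rewrite ltr_pdivrMr // ltr_pMr // ltr1n.
Qed.

End ExpEstimates.


(** * Uniform approximation by complex functions *)

Section Topology.
Context {R : realType}.

Lemma complex_gt0 (e : R[i]) : 0 < e -> exists2 r : R, 0 < r & e = r%:C%C.
Proof.
case: e => a b; rewrite ltcE /= => /andP[/eqP -> a0].
by exists a.
Qed.

Lemma cvg_normcP {T : Type} {F : set_system T} {FF : Filter F}
    (f : T -> R[i]^o) (l : R[i]^o) :
  f @ F --> l <-> forall e : R, 0 < e -> \forall x \near F, normc (l - f x) < e.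
Proof.
split.
  move/cvgrPdist_lt => H e e0.
  have : (0 : R[i]) < e%:C%C by rewrite ltcR.
  by move=> /H; apply: filterS => x h; rewrite -ltcR.
move=> H; apply/cvgrPdist_lt => _/complex_gt0[e e0 ->].
by apply: filterS (H _ e0) => x h; rewrite -ltcR in h.
Qed.

(** The norm of [R[i]^o] has its values in [R[i]]; the real-valued [normc] and
    real radii make the estimates accessible to linear arithmetic over [R]. *)
Lemma closure_uniformP {X : topologicalType} (B : set (X -> R[i]^o)) g :
  closure (B : set {uniform X -> R[i]^o}) g <->
  forall e : R, 0 < e -> exists2 h, B h & forall x, normc (g x - h x) < e.
Proof.
split=> [cl e e0|H P /uniform_nbhs[E [entE EP]]].
  have /cl[h [Bh hP]] : nbhs (g : {uniform X -> R[i]^o})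
      [set h | forall x, normc (g x - h x) < e].
    apply/uniform_nbhs; exists [set xy | ball xy.1 (e%:C%C : R[i]) xy.2].
    split; first by rewrite -entourage_ballE; exists (e%:C%C) => //=; rewrite ltcR.
    move=> h /= H x; have := H x I.
    by rewrite -ball_normE /= => hx; rewrite -ltcR.
  by exists h.
have := entE; rewrite -entourage_ballE => -[_/= /complex_gt0[e e0 ->] eE].
have [h Bh hP] := H _ e0; exists h; split=> //; apply: EP => x _.
by apply: eE; rewrite /= -ball_normE /=; have := hP x; rewrite -ltcR.
Qed.

Lemma closed_uniformP {X : topologicalType} (B : set (X -> R[i]^o)) :
  closed (B : set {uniform X -> R[i]^o}) <->
  forall g, (forall e : R, 0 < e -> exists2 h, B h &
    forall x, normc (g x - h x) < e) -> B g.
Proof.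
split=> [cB g /closure_uniformP|H g /closure_uniformP]; first exact: cB.
exact: H.
Qed.

Lemma compact_normc_bounded {X : topologicalType} (f : X -> R[i]^o) :
  compact [set: X] -> continuous f ->
  exists2 M : R, 0 < M & forall x, normc (f x) <= M.
Proof.
move=> cX cf; have [[x0 _]|X0] := pselect (exists x : X, True); last first.
  by exists 1 => // x; case: X0; exists x.
have cn : continuous (fun x => normc (f x) : R).
  move=> x; apply/cvgrPdist_lt => e e0 /=.
  have /cvg_normcP/(_ _ e0) := cf x; apply: filterS => y; apply: le_lt_trans.
  have := le_normcD (f x - f y) (f y); have := le_normcD (f y - f x) (f x).
  rewrite !subrK normc_distC ler_norml => h1 h2; apply/andP; split; lra.
have [] := @compact_EVT_max X R (fun x => normc (f x)) setT _ cX _; first by exists x0.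
  exact: continuous_subspaceT.
move=> c _ cM; exists (normc (f c) + 1).
  by have := normc_ge0 (f c); lra.
by move=> x; have := cM x; rewrite inE => /(_ I) /=; lra.
Qed.

End Topology.

(** * Logarithms in closed unital subalgebras *)

Section UnitalSubalgebra.
Context {R : realType} {Y : topologicalType}.
Implicit Types (B : set (Y -> R[i]^o)) (f g : Y -> R[i]^o).

(** A uniform algebra up to the separation of points, which fails for the
    functions pulled back to [Y] from a quotient. *)
Record unital_subalgebra B : Prop := {
  us_subalgebra : closed_subalgebra B;
  us_cst : forall c, B (cst c) }.

Lemma uniform_algebra_unital B : uniform_algebra B -> unital_subalgebra B.
Proof. by move=> uB; split; [exact: ua_subalgebra|exact: ua_cst]. Qed.

Section Closure.
Variables (B : set (Y -> R[i]^o)) (hB : unital_subalgebra B).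
Let csB := us_subalgebra hB.

Lemma us_add f g : B f -> B g -> B (fun y => f y + g y).
Proof. exact: (csa_add csB). Qed.

Lemma us_mul f g : B f -> B g -> B (fun y => f y * g y).
Proof. exact: (csa_mul csB). Qed.

Lemma us_scale (c : R[i]^o) f : B f -> B (fun y => c * f y).
Proof. exact: (csa_scale csB). Qed.

Lemma us_opp f : B f -> B (fun y => - f y).
Proof.
move=> Bf; rewrite (_ : (fun _ => _) = (fun y => (-1 : R[i]^o) * f y)).
  exact: us_scale.
by apply/funext => y; rewrite mulN1r.
Qed.

Lemma us_sub f g : B f -> B g -> B (fun y => f y - g y).
Proof. by move=> Bf Bg; apply: us_add => //; exact: us_opp. Qed.

Lemma us_exp f n : B f -> B (fun y => f y ^+ n).
Proof.
move=> Bf; elim: n => [|n IH].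
  by rewrite (_ : (fun _ => _) = cst 1) //; exact: us_cst.
rewrite (_ : (fun _ => _) = (fun y => f y * f y ^+ n)); first exact: us_mul.
by apply/funext => y; rewrite exprS.
Qed.

Lemma us_sum (J : Type) (s : seq J) (P : pred J) (F : J -> Y -> R[i]^o) :
  (forall j, P j -> B (F j)) -> B (fun y => \sum_(j <- s | P j) F j y).
Proof.
move=> BF; elim: s => [|j s IH].
  rewrite (_ : (fun _ => _) = cst 0); first exact: us_cst.
  by apply/funext => y; rewrite big_nil.
have [Pj|nPj] := boolP (P j); last first.
  rewrite (_ : (fun _ => _) = (fun y => \sum_(j <- s | P j) F j y)) //.
  by apply/funext => y; rewrite big_cons (negbTE nPj).
rewrite (_ : (fun _ => _) = (fun y => F j y + \sum_(j <- s | P j) F j y)).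
  by apply: us_add => //; exact: BF.
by apply/funext => y; rewrite big_cons Pj.
Qed.

Lemma us_horner (p : {poly R[i]}) f : B f -> B (fun y => p.[f y]).
Proof.
move=> Bf; rewrite (_ : (fun _ => _) =
  (fun y => \sum_(i < size p) (p`_i : R[i]^o) * f y ^+ i)).
  by apply: us_sum => i _; apply: us_scale; exact: us_exp.
by apply/funext => y; rewrite horner_coef.
Qed.

Lemma us_limit g : (forall e : R, 0 < e -> exists2 h, B h &
  forall y, normc (g y - h y) < e) -> B g.
Proof. by move/closed_uniformP: (csa_closed csB); exact. Qed.

Hypothesis cY : compact [set: Y].

Lemma us_cexp g : B g -> B (fun y => cexp (g y)).
Proof.
move=> Bg.
have [M M0 gM] := compact_normc_bounded cY (csa_continuous csB Bg).
apply: us_limit => e e0; have [n nP] := cexp_powers M0 e0.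
exists (fun y => (1 + n.+1%:R^-1 * g y) ^+ n.+1) => [|y]; last exact: nP.
apply: us_exp; apply: us_add; last exact: us_scale.
exact: us_cst.
Qed.

Lemma us_limit_geom (c : R) (h : nat -> Y -> R[i]^o) g : (forall n, B (h n)) ->
  (forall n y, normc (g y - h n y) < c / 2 ^+ n) -> B g.
Proof.
move=> Bh H; apply: us_limit => e e0.
have [c0|c0] := leP c 0.
  exists (h 0%N) => // y; apply: lt_trans (H _ _) _.
  by apply: le_lt_trans e0; rewrite expr0 divr1.
exists (h (Num.truncn (c / e))) => // y; apply: lt_trans (H _ _) _.
rewrite ltr_pdivrMr ?exprn_gt0 // mulrC -ltr_pdivrMr //.
apply: lt_le_trans (truncnS_gt _) _.
by rewrite -natrX ler_nat ltn_expl.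
Qed.

End Closure.
End UnitalSubalgebra.

(** Newton's method for [cexp l = f], started in [B], stays in [B].  Its error
    [d] becomes [d - (cexp d - 1)], of norm at most [normc d / 2] when [d] is
    small, so that [g] is a uniform limit of elements of [B]. *)
Lemma us_log_near (R : realType) : exists2 c : R, 0 < c &
  forall (Y : topologicalType) (B : set (Y -> R[i]^o)) (f g g' : Y -> R[i]^o),
    compact [set: Y] -> unital_subalgebra B ->
    B f -> f = cexp \o g -> B g' ->
    (forall y, normc (g y - g' y) < c) -> B g.
Proof.
have [c c0 cP] := @cexp_near R; exists c => // Y B f g g' cY hB Bf fE Bg' gg'.
pose l := fix l n : Y -> R[i]^o := if n is m.+1 then
  (fun y => l m y + (f y * cexp (- l m y) - 1)) else g'.
apply: (us_limit_geom hB (c := c) (h := l)).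
  elim=> [|n IH] //=; apply: (us_add hB) => //; apply: (us_sub hB).
    by apply: (us_mul hB) => //; apply: (us_cexp hB) => //; exact: us_opp.
  exact: us_cst.
elim=> [y|n IH y]; first by rewrite expr0 divr1.
have := IH y; set d := g y - l n y => dn.
have -> : g y - l n.+1 y = - (cexp d - 1 - d).
  by rewrite /= {1}fE /= -cexpD /d; ring.
rewrite normcN; have := cP d; rewrite exprS invfM mulrA.
have p1 : (1 : R) <= 2 ^+ n by rewrite exprn_ege1 // ler1n.
have : c / 2 ^+ n <= c by rewrite ler_pdivrMr ?exprn_gt0 // ler_peMr // ltW.
move=> h1 h2; apply: le_lt_trans (h2 (lt_le_trans dn h1)) _.
by rewrite [X in _ < X]mulrAC [ltRHS]mulrC ltr_pM2l.
Qed.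

Lemma interpolation (F : fieldType) (s : seq F) (L : F -> F) :
  exists p : {poly F}, {in s, forall z, p.[z] = L z}.
Proof.
elim: s => [|x s [p pP]]; first by exists 0.
have [xs|xs] := boolP (x \in s).
  by exists p => z; rewrite inE => /orP[/eqP->|]; exact: pP.
pose q := \prod_(z <- s) ('X - z%:P).
have qx : q.[x] != 0 by rewrite -rootE root_prod_XsubC.
exists (p + ((L x - p.[x]) / q.[x])%:P * q) => z; rewrite inE !hornerE.
case/orP => [/eqP->|zs]; first by rewrite divfK // addrC subrK.
have /rootP-> : root q z by rewrite root_prod_XsubC.
by rewrite mulr0 addr0 pP.
Qed.

(** The roots of unity of a given order are finitely many: interpolate a
    logarithm at them. *)
Lemma unity_log (R : realType) n : exists p : {poly R[i]},
  forall w : R[i]^o, cexp w ^+ n.+1 = 1 -> cexp (p.[cexp w] : R[i]^o) = cexp w.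
Proof.
have [s sE] := closed_field_poly_normal ('X^(n.+1) - 1 : {poly R[i]}).
have [p pP] := interpolation s (fun z => xget (0 : R[i]) [set w | cexp w = z]).
exists p => w w1.
have ws : cexp w \in s.
  rewrite -root_prod_XsubC; have : root ('X^(n.+1) - 1 : {poly R[i]}) (cexp w).
    by rewrite rootE !hornerE w1 subrr.
  by rewrite sE rootZ // lead_coef_eq0 -size_poly_eq0 size_XnsubC.
by rewrite pP //; case: xgetP => [y -> //|/(_ w)]; case.
Qed.

(** The transfer argument.  With [m] the average of [g] over the maps [tau i],
    [f ^ n = cexp (n * m)]; the quotient of [f] by [cexp m] has its values in
    the [n]-th roots of unity and [unity_log] gives it a logarithm in [B].  The
    maps [tau i] stand for an enumeration of the fibres of a branched cover,
    which has no continuous choice in general; only sums over [i] are regular. *)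
Lemma averaged_log (R : realType) (Y : topologicalType)
    (B B' : set (Y -> R[i]^o)) n (tau : 'I_n -> Y -> Y) (f g : Y -> R[i]^o) :
  compact [set: Y] -> (Y -> (0 < n)%N) -> unital_subalgebra B ->
  (forall i b y, B b -> b (tau i y) = b y) ->
  (forall h, B' h -> B (fun y => \sum_i h (tau i y))) ->
  B f -> B' g -> f = cexp \o g -> exponentials B f.
Proof.
case: n tau => [|n] tau cY n0 hB tauB sumB Bf Bg fE.
  (* Without maps [tau i] the space is empty. *)
  exists (cst 0); first exact: us_cst.
  by apply/funext => y; have := n0 y.
pose m y : R[i]^o := n.+1%:R^-1 * \sum_i g (tau i y).
have Bm : B m by apply: (us_scale hB); exact: sumB.
have [p pP] := unity_log R n.
pose w y := f y * cexp (- m y).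
have Bw : B w.
  by apply: (us_mul hB) => //; apply: (us_cexp hB) => //; exact: us_opp.
exists (fun y => m y + p.[w y]).
  by apply: (us_add hB) => //; exact: us_horner.
apply/funext => y /=; rewrite cexpD.
have wE : w y = cexp (g y - m y) by rewrite /w fE /= -cexpD.
rewrite wE pP -?wE; first by rewrite /w mulrCA cexp_unit mulr1.
rewrite /w exprMn -cexpMn mulNrn.
have -> : m y *+ n.+1 = \sum_i g (tau i y).
  by rewrite -mulr_natl mulrA divff ?mul1r // pnatr_eq0.
suff -> : f y ^+ n.+1 = cexp (\sum_i g (tau i y)) by exact: cexp_unit.
have -> : cexp (\sum_i g (tau i y)) = \prod_i cexp (g (tau i y)).
  by elim/big_ind2: _ => [|z z' w1 w' <- <-|//]; [exact: cexp0|exact: cexpD].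
rewrite (eq_bigr (fun=> f y)) ?prodr_const ?card_ord // => i _.
by rewrite -(tauB i f y Bf) fE.
Qed.

(** * Newton's identities *)

Lemma deriv_prod_seq (F : comNzRingType) (J : eqType) (s : seq J)
    (p : J -> {poly F}) : uniq s ->
  (\prod_(i <- s) p i)^`() =
  \sum_(i <- s) (p i)^`() * \prod_(j <- s | j != i) p j.
Proof.
elim: s => [|x s IH] /=; first by rewrite !big_nil -polyC1 derivC.
move=> /andP[xs us]; rewrite !big_cons derivM IH // eqxx /=; congr (_ * _ + _).
  rewrite [LHS]big_seq [RHS]big_seq_cond; apply: eq_bigl => j.
  by case: eqVneq => [->|_]; rewrite ?(negbTE xs) ?andbF ?andbT.
rewrite mulr_sumr; apply: eq_big_seq => i i_s.
rewrite big_cons ifT 1?mulrCA //; by apply: contraNneq xs => ->.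
Qed.

Section Newton.
Context {F : fieldType} {n : nat} (r : 'I_n -> F).

Definition root_prod : {poly F} := \prod_i ('X - (r i)%:P).
Let q := root_prod.

Lemma size_root_prod : size q = n.+1.
Proof. by rewrite /q /root_prod -big_enum size_prod_XsubC size_enum_ord. Qed.

Lemma root_prod_coef_lead : q`_n = 1.
Proof.
have /monicP := monic_prod_XsubC (index_enum 'I_n) predT r.
by rewrite lead_coefE size_root_prod.
Qed.

(** The coefficients of the quotient of [q] by ['X - r i] are the partial sums of
    the Horner scheme of [q] at [r i]. *)
Lemma coef_root_prod_except i k : (k < n)%N ->
  (\prod_(j | j != i) ('X - (r j)%:P))`_(n.-1 - k) =
  \sum_(j < k.+1) q`_(n - k + j) * r i ^+ j.
Proof.
set Q := \prod_(j | _) _ => kn.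
have qE : q = ('X - (r i)%:P) * Q by rewrite /q /root_prod (bigD1 i).
have sQ : size Q = n.
  have := size_root_prod; rewrite qE size_monicM ?monic_neq0 ?monicXsubC ?monic_prod_XsubC //.
  by rewrite size_XsubC => -[].
elim: k kn => [|k IH] kn.
  rewrite big_ord1 !subn0 addn0 root_prod_coef_lead mul1r expr0.
  have /monicP := monic_prod_XsubC (index_enum 'I_n) (fun j => j != i) r.
  by rewrite lead_coefE sQ.
rewrite big_ord_recl addn0 expr0 mulr1.
have := congr1 (fun p : {poly F} => p`_(n - k.+1)) qE.
rewrite mulrBl coefB coefXM coefCM (_ : (n - k.+1 == 0)%N = false); last by lia.
rewrite (_ : (n - k.+1).-1 = n.-1 - k.+1)%N; last by lia.
move=> ->; rewrite -[LHS](subrK (r i * Q`_(n - k.+1))); congr (_ + _).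
rewrite (_ : n - k.+1 = n.-1 - k)%N; last by lia.
rewrite IH ?(ltnW kn) // mulr_sumr; apply: eq_bigr => j _.
rewrite lift0 exprS mulrCA; congr (q`_ _ * _); lia.
Qed.

Definition power_sum k := \sum_i r i ^+ k.

(** The derivative of [q] is the sum of its quotients by the ['X - r i]; compare
    coefficients. *)
Lemma newton_lt k : (k < n)%N ->
  power_sum k = q`_(n - k) *+ (n - k) - \sum_(j < k) q`_(n - k + j) * power_sum j.
Proof.
move=> kn; apply: (canRL (addrK _)).
have -> : q`_(n - k) *+ (n - k) = q^`()`_(n.-1 - k).
  by rewrite coef_deriv (_ : (n.-1 - k).+1 = n - k)%N //; lia.
have -> : q^`() = \sum_i \prod_(j | j != i) ('X - (r j)%:P).
  rewrite /q /root_prod -big_enum deriv_prod_seq ?enum_uniq // big_enum /=.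
  by apply: eq_bigr => i _; rewrite derivXsubC mul1r big_enum_cond.
rewrite coef_sum; under [RHS]eq_bigr do rewrite coef_root_prod_except //.
rewrite exchange_big big_ord_recr /= addrC; congr (_ + _).
  by rewrite -mulr_sumr subnK ?(ltnW kn) // root_prod_coef_lead mul1r.
by apply: eq_bigr => j _; rewrite -mulr_sumr.
Qed.

(** Sum the equations [q.[r i] = 0], each multiplied by [r i ^ (k - n)]. *)
Lemma newton_ge k : (n <= k)%N ->
  power_sum k = - \sum_(j < n) q`_j * power_sum (k - n + j).
Proof.
move=> nk; apply/eqP; rewrite -addr_eq0 /power_sum.
under [X in _ + X]eq_bigr do rewrite mulr_sumr.
rewrite exchange_big /= -big_split /=; apply/eqP; apply: big1 => i _.
have : q.[r i] = 0.
  by rewrite /q /root_prod (bigD1 i) //= !hornerE subrr mul0r.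
rewrite horner_coef size_root_prod big_ord_recr /= root_prod_coef_lead mul1r => h.
transitivity (r i ^+ (k - n) * (\sum_(j < n) q`_j * r i ^+ j + r i ^+ n)); last first.
  by rewrite h mulr0.
rewrite mulrDr -exprD subnK // addrC; congr (_ + _); rewrite mulr_sumr; apply: eq_bigr => j _.
by rewrite exprD mulrCA.
Qed.

End Newton.

(** Symmetric functions of the roots return to the algebra of the coefficients. *)
Lemma us_power_sum (R : realType) (Y : topologicalType)
    (B : set (Y -> R[i]^o)) n (r : 'I_n -> Y -> R[i]^o) k :
  unital_subalgebra B ->
  (forall j, B (fun y => (root_prod (r ^~ y))`_j)) ->
  B (fun y => \sum_i r i y ^+ k).
Proof.
move=> hB Bq; elim/ltn_ind: k => k IH.
have [kn|nk] := ltnP k n.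
  rewrite (_ : (fun _ => _) = (fun y => (n - k)%:R * (root_prod (r ^~ y))`_(n - k) -
    \sum_(j < k) (root_prod (r ^~ y))`_(n - k + j) * power_sum (r ^~ y) j)); last first.
    by apply/funext => y; rewrite mulr_natl -newton_lt.
  apply: (us_sub hB); first exact: us_scale.
  by apply: (us_sum hB) => j _; apply: (us_mul hB) => //; apply: IH.
rewrite (_ : (fun _ => _) = (fun y =>
  - \sum_(j < n) (root_prod (r ^~ y))`_j * power_sum (r ^~ y) (k - n + j))); last first.
  by apply/funext => y; rewrite -newton_ge.
apply: (us_opp hB); apply: (us_sum hB) => j _; apply: (us_mul hB) => //; apply: IH.
by have := ltn_ord j; lia.
Qed.

(** * Ultrafilters, oscillation and quotients *)

Section Ultrafilters.

(** Every map into a compact space converges along an ultrafilter, so that limits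
    can be taken of objects chosen without continuity, such as an enumeration
    of the roots of a varying polynomial. *)
Lemma ultra_cvg {T : Type} {Z : topologicalType} (F : set_system T)
    (f : T -> Z) (l : Z) :
  Filter F -> (forall G, UltraFilter G -> F `<=` G -> f @ G --> l) -> f @ F --> l.
Proof.
move=> FF H A Al; apply: contrapT => nFA.
have PF : ProperFilter (within (~` (f @^-1` A)) F).
  split; last exact: within_filter.
  by move=> h; apply: nFA; rewrite /within /= in h; apply: filterS h => x nAx;
    apply: contrapT => /nAx.
have [G [GU FG]] := ultraFilterLemma PF.
have GA : G (f @^-1` A).
  apply: (H G GU _ A Al) => B FB; apply: FG; rewrite /within /=.
  by apply: filterS FB.
have GnA : G (~` (f @^-1` A)).
  by apply: FG; rewrite /within /=; apply: filterE.
have : G set0 by rewrite -(setICr (f @^-1` A)); exact: filterI.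
exact: filter_not_empty.
Qed.

Lemma ultra_map {T V : Type} (f : T -> V) (F : set_system T) :
  UltraFilter F -> UltraFilter (f @ F).
Proof.
move=> FU; split; first exact: fmap_proper_filter.
move=> G GF FG; rewrite predeqE => A; split; last exact: FG.
move=> GA; have [//|FnA] := in_ultra_setVsetC (f @^-1` A) FU.
have GnA : G (~` A) by exact: FG.
exfalso; have : G set0 by rewrite -(setICr A); exact: filterI.
exact: filter_not_empty.
Qed.

Lemma compact_ultra_map {T : Type} {Y : topologicalType} (f : T -> Y)
    (F : set_system T) :
  compact [set: Y] -> UltraFilter F -> exists y : Y, f @ F --> y.
Proof.
rewrite compact_ultra => cY FU.
have [|y [_ Fy]] := cY _ (ultra_map f FU); first exact: filterT.
by exists y.
Qed.

(** Otherwise the pairs of related points at which [g] varies by [c]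
    accumulate at a pair that none of the maps [q] separates: a point of the
    diagonal, where [g] is continuous. *)
Lemma compact_directed_oscillation {R : realType} {Y : topologicalType} {J : Type}
    (E : J -> Y -> Y -> Prop) (g : Y -> R[i]^o) (c : R) :
  compact [set: Y] -> continuous g -> 0 < c -> inhabited J ->
  (forall j k, exists l, forall y y', E l y y' -> E j y y' /\ E k y y') ->
  (forall y y', y <> y' -> exists j (Z : topologicalType) (q : Y -> Z),
    [/\ hausdorff_space Z, continuous q, q y <> q y' &
        forall z z', E j z z' -> q z = q z']) ->
  exists j, forall y y', E j y y' -> normc (g y - g y') < c.
Proof.
move=> cY cg c0 [j0] dirE sepE; apply: contrapT => nE.
pose D j : set (Y * Y) := [set p | E j p.1 p.2 /\ c <= normc (g p.1 - g p.2)].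
have FP : ProperFilter (filter_from setT D).
  apply: filter_from_proper; last first.
    move=> j _; apply: contrapT => Dj; apply: nE; exists j => y y' yy'.
    by rewrite ltNge; apply/negP => h; apply: Dj; exists (y, y').
  apply: filter_from_filter; first by exists j0.
  move=> j k _ _; have [l lP] := dirE j k; exists l => //.
  by move=> [y y'] [/lP[? ?] ?].
have [G [GU FG]] := ultraFilterLemma FP.
have GD j : G (D j) by apply: FG; exists j.
have [y Gy] := compact_ultra_map fst cY GU.
have [y' Gy'] := compact_ultra_map snd cY GU.
have yy' : y = y'.
  apply: contrapT => /sepE [j [Z [q [hZ cq qn qE]]]]; apply: qn.
  have q1 : (q \o fst) @ G --> q y by apply: (cvg_comp _ _ Gy); exact: cq.
  have q2 : (q \o snd) @ G --> q y' by apply: (cvg_comp _ _ Gy'); exact: cq.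
  apply: (cvg_unique hZ q1); apply: cvg_trans q2.
  apply: near_eq_cvg; apply: filterS (GD j) => -[z z'] [/= zz' _].
  by rewrite (qE z z').
rewrite -{}yy' in Gy'.
have h : (fun p : Y * Y => g p.1 - g p.2) @ G --> g y - g y.
  by apply: cvgB; [apply: (cvg_comp _ _ Gy)|apply: (cvg_comp _ _ Gy')]; exact: cg.
have /cvg_normcP/(_ _ c0) h2 := h.
have [p [/= h3 [_ h4]]] := filter_ex (filterI h2 (GD j0)).
by move: h3; rewrite subrr sub0r normcN ltNge h4.
Qed.

End Ultrafilters.

(** A continuous surjection from a compact space to a Hausdorff one is closed,
    hence a quotient map. *)
Lemma continuous_factor {X Y Z : topologicalType} (q : Y -> X) (f : X -> Z) :
  compact [set: Y] -> hausdorff_space X -> continuous q ->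
  (forall x, exists y, q y = x) -> continuous (f \o q) -> continuous f.
Proof.
move=> cY hX cq sq cfq; apply/continuous_closedP => C cC.
have -> : f @^-1` C = q @` ((f \o q) @^-1` C).
  rewrite eqEsubset; split=> [x fx|_ [y fy <-]] //.
  by have [y yx] := sq x; exists y => //=; rewrite yx.
apply: (compact_closed hX); apply: continuous_compact.
  exact: continuous_subspaceT.
apply: (subclosed_compact _ cY) => //.
by move/continuous_closedP: cfq; exact.
Qed.

(** * Algebras of continuous functions *)

Section FunctionAlgebras.
Context {R : realType} {Y : topologicalType}.
Implicit Types (B : set (Y -> R[i]^o)) (f g h : Y -> R[i]^o).

Lemma continuous_uniform_limit g :
  (forall e : R, 0 < e -> exists2 h, continuous h & forall y, normc (g y - h y) < e) ->
  continuous g.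
Proof.
move=> H y; apply/cvg_normcP => e e0.
have [|h ch gh] := H (e / 3); first by rewrite divr_gt0 // ltr0n.
have /cvg_normcP/(_ (e / 3)) := ch y.
rewrite divr_gt0 // ?ltr0n // => /(_ isT); apply: filterS => x hx.
have -> : g y - g x = (g y - h y) + ((h y - h x) - (g x - h x)).
  by rewrite opprB !addrA !subrK.
apply: le_lt_trans (le_normcD _ _) _; have := le_normcD (h y - h x) (- (g x - h x)).
rewrite normcN; have := gh y; have := gh x; lra.
Qed.

(** The continuous functions on the quotient of [Y] by [E]. *)
Definition invariant_continuous (E : Y -> Y -> Prop) : set (Y -> R[i]^o) :=
  [set f | continuous f /\ forall y y', E y y' -> f y = f y'].

Lemma invariant_continuous_unital E : unital_subalgebra (invariant_continuous E).
Proof.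
split=> [|c]; last by split=> // y; exact: cvg_cst.
split=> [f []||f g [cf Ef] [cg Eg]|c f [cf Ef]|f g [cf Ef] [cg Eg]|] //.
- by split=> // y; exact: cvg_cst.
- split=> [y|y y' yy']; first by apply: cvgD; [exact: cf|exact: cg].
  by rewrite /= (Ef _ _ yy') (Eg _ _ yy').
- split=> [y|y y' yy']; first by apply: cvgM; [exact: cvg_cst|exact: cf].
  by rewrite (Ef _ _ yy').
- split=> [y|y y' yy']; first by apply: cvgM; [exact: cf|exact: cg].
  by rewrite /= (Ef _ _ yy') (Eg _ _ yy').
apply/closed_uniformP => g gP; split.
  apply: continuous_uniform_limit => e e0.
  by have [h [ch _] gh] := gP _ e0; exists h.
move=> y y' yy'; apply/eqP; rewrite -subr_eq0; apply/eqP/eq0_normc/eqP.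
rewrite eq_le normc_ge0 andbT; apply/ler_addgt0Pl => e e0; rewrite addr0.
have [|h [_ Eh] gh] := gP (e / 2); first by rewrite divr_gt0 // ltr0n.
have -> : g y - g y' = (g y - h y) - (g y' - h y').
  by rewrite (Eh _ _ yy') opprB addrA subrK.
apply: le_trans (le_normcD _ _) _; rewrite normcN.
by have := gh y; have := gh y'; lra.
Qed.

Definition continuous_functions : set (Y -> R[i]^o) := [set f | continuous f].

Lemma continuous_functions_unital : unital_subalgebra continuous_functions.
Proof.
have -> : continuous_functions = invariant_continuous (fun _ _ => False).
  by rewrite eqEsubset; split=> [f cf|f []].
exact: invariant_continuous_unital.
Qed.

Lemma smallest_subalgebra (G : set (Y -> R[i]^o)) : (forall g, G g -> continuous g) ->
  closed_subalgebra (smallest closed_subalgebra G).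
Proof.
move=> cG; split.
- move=> f /(_ _ (conj (us_subalgebra continuous_functions_unital) cG)) //.
- by move=> A [hA _]; exact: csa_zero.
- by move=> f g hf hg A hA; apply: (csa_add hA.1); [exact: hf|exact: hg].
- by move=> c f hf A hA; apply: (csa_scale hA.1); exact: hf.
- by move=> f g hf hg A hA; apply: (csa_mul hA.1); [exact: hf|exact: hg].
apply/closed_uniformP => g gP A hA; move: (csa_closed hA.1) => /closed_uniformP; apply.
by move=> e /gP[h hh gh]; exists h => //; exact: hh.
Qed.

Lemma closure_of_subalgebra B : compact [set: Y] -> (forall f, B f -> continuous f) ->
  B (cst 0) -> (forall f g, B f -> B g -> B (f \+ g)) ->
  (forall (c : R[i]^o) f, B f -> B (fun x => c * f x)) ->
  (forall f g, B f -> B g -> B (f \* g)) ->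
  closed_subalgebra (closure (B : set {uniform Y -> R[i]^o})).
Proof.
move=> cY cB B0 BD BZ BM; split.
- move=> f /closure_uniformP fP; apply: continuous_uniform_limit => e /fP[h Bh fh].
  by exists h => //; exact: cB.
- exact: subset_closure.
- move=> f g /closure_uniformP fP /closure_uniformP gP; apply/closure_uniformP => e e0.
  have e2 : 0 < e / 2 by rewrite divr_gt0 // ltr0n.
  have [h Bh fh] := fP _ e2; have [k Bk gk] := gP _ e2.
  exists (h \+ k); first exact: BD.
  move=> y /=; rewrite opprD addrACA; apply: le_lt_trans (le_normcD _ _) _.
  by have := fh y; have := gk y; lra.
- move=> c f /closure_uniformP fP; apply/closure_uniformP => e e0.
  have c1 : 0 < normc c + 1 by have := normc_ge0 c; lra.
  have [|h Bh fh] := fP (e / (normc c + 1)); first by rewrite divr_gt0.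
  exists (fun x => c * h x); first exact: BZ.
  move=> y; rewrite -mulrBr normcM; have := fh y; rewrite ltr_pdivlMr //.
  by have := normc_ge0 (f y - h y); nra.
- move=> f g fP gP; apply/closure_uniformP => e e0.
  have cf : continuous f.
    apply: continuous_uniform_limit => d d0.
    by have /closure_uniformP/(_ _ d0)[h Bh ?] := fP; exists h => //; exact: cB.
  have [M M0 fM] := compact_normc_bounded cY cf.
  have /closure_uniformP/(_ (e / (2 * M)))[|k Bk gk] := gP.
    by rewrite divr_gt0 // mulr_gt0 // ltr0n.
  have [N N0 kN] := compact_normc_bounded cY (cB _ Bk).
  have /closure_uniformP/(_ (e / (2 * N)))[|h Bh fh] := fP.
    by rewrite divr_gt0 // mulr_gt0 // ltr0n.
  exists (h \* k); first exact: BM.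
  move=> y /=.
  have -> : f y * g y - h y * k y = f y * (g y - k y) + k y * (f y - h y) by ring.
  apply: le_lt_trans (le_normcD _ _) _; rewrite !normcM.
  have := gk y; have := fh y; have := fM y; have := kN y.
  rewrite !ltr_pdivlMr ?mulr_gt0 // ?ltr0n //.
  have := normc_ge0 (g y - k y); have := normc_ge0 (f y - h y).
  have := normc_ge0 (f y); have := normc_ge0 (k y); nra.
exact: closed_closure.
Qed.

End FunctionAlgebras.
Arguments continuous_functions : clear implicits.

(** Since [q] is surjective, uniform distances on [X] can be measured on [Y];
    this is why the pulled back algebra is closed. *)
Lemma pullback_unital (R : realType) (X Y : topologicalType) (q : Y -> X)
    (A : set (X -> R[i]^o)) :
  continuous q -> (forall x, exists y, q y = x) -> unital_subalgebra A ->
  unital_subalgebra [set f \o q | f in A].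
Proof.
move=> cq sq hA; split; last first.
  by move=> c; exists (cst c) => //; exact: us_cst.
have csA := us_subalgebra hA; split.
- move=> _ [f Af <-] y; apply: (continuous_comp (cq y)).
  exact: (csa_continuous csA).
- by exists (cst 0) => //; exact: csa_zero.
- by move=> _ _ [f Af <-] [g Ag <-]; exists (f \+ g) => //; exact: csa_add.
- by move=> c _ [f Af <-]; exists (fun x => c * f x) => //; exact: csa_scale.
- by move=> _ _ [f Af <-] [g Ag <-]; exists (f \* g) => //; exact: csa_mul.
apply/closed_uniformP => g gP.
have /choice[s sP] := sq.
have gE : g = (g \o s) \o q.
  apply/funext => y; apply/eqP; rewrite -subr_eq0; apply/eqP/eq0_normc/eqP.
  rewrite eq_le normc_ge0 andbT; apply/ler_addgt0Pl => e e0; rewrite addr0.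
  have [|_ [h Ah <-] gh] := gP (e / 2); first by rewrite divr_gt0 // ltr0n.
  have := gh (s (q y)); have := gh y; rewrite /= sP => h1 h2.
  have -> : g y - g (s (q y)) = (g y - h (q y)) - (g (s (q y)) - h (q y)) by ring.
  by apply: le_trans (le_normcD _ _) _; rewrite normcN; lra.
exists (g \o s) => //; apply: (us_limit hA) => e /gP[_ [h Ah <-] gh].
by exists h => // x; have := gh (s x); rewrite /= sP.
Qed.

Section Adjunction.
Context {R : realType} {Y : topologicalType}.

(** Summation over the maps [tau i] is linear over [B] but not multiplicative:
    the functions whose sums lie in [B] need not form an algebra, but the
    multipliers of such a space do.  Here [D] is the space of the [h] for which
    all sums of [p ^ k * h] lie in [B], and [M] the algebra of the functions
    that multiply [D] into itself.  As [M] contains [B] and [p], it contains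
    the algebra they generate; and [D] contains [1]. *)
Lemma sum_adjunction (B : set (Y -> R[i]^o)) n (tau : 'I_n -> Y -> Y) (p : Y -> R[i]^o) :
  compact [set: Y] -> unital_subalgebra B -> continuous p ->
  (forall i b y, B b -> b (tau i y) = b y) ->
  (forall k, B (fun y => \sum_i p (tau i y) ^+ k)) ->
  forall h, smallest closed_subalgebra (B `|` [set p]) h ->
    B (fun y => \sum_i h (tau i y)).
Proof.
move=> cY hB cp tauB sumB h0 hh0.
have [N N0 pN] := compact_normc_bounded cY cp.
pose T k (h : Y -> R[i]^o) (y : Y) : R[i]^o := \sum_i p (tau i y) ^+ k * h (tau i y).
pose D : set (Y -> R[i]^o) := [set h | continuous h /\ forall k, B (T k h)].
have D_limit (g : Y -> R[i]^o) : (forall e : R, 0 < e -> exists2 h, D h &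
    forall y, normc (g y - h y) < e) -> D g.
  move=> gP; split.
    by apply: continuous_uniform_limit => e /gP[h [ch _] gh]; exists h.
  move=> k; apply: (us_limit hB) => e e0.
  pose K := (n).+1%:R * N ^+ k.
  have K0 : 0 < K by rewrite mulr_gt0 ?exprn_gt0 // ltr0n.
  have [|h [_ Dh] gh] := gP (e / K); first by rewrite divr_gt0.
  exists (T k h) => // y; rewrite /T -sumrB.
  apply: le_lt_trans (_ : \sum_(i < n) N ^+ k * (e / K) < _).
    apply: (big_ind2 (fun (z : R[i]^o) (r : R) => normc z <= r)).
    - by rewrite normc0.
    - by move=> z r z' r' zr zr'; apply: le_trans (le_normcD _ _) _; apply: lerD.
    move=> i _; rewrite -mulrBr normcM normcX; apply: ler_pM; rewrite ?exprn_ge0 ?normc_ge0 //.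
      by rewrite lerXn2r // ?nnegrE ?normc_ge0 // ltW.
    exact: ltW.
  rewrite sumr_const card_ord -mulr_natl; set w := N ^+ k * (e / K).
  have w0 : 0 < w by rewrite mulr_gt0 ?exprn_gt0 // divr_gt0.
  have -> : e = (n).+1%:R * w.
    by rewrite /w /K; field; rewrite expf_neq0 ?gt_eqF // ltr0n.
  by rewrite ltr_pM2r // ltr_nat.
pose M : set (Y -> R[i]^o) := [set h : Y -> R[i]^o |
  continuous h /\ forall h', D h' -> D (h \* h')].
have cM (f g : Y -> R[i]^o) : continuous f -> continuous g -> continuous (f \* g).
  by move=> cf cg y; apply: cvgM; [exact: cf|exact: cg].
have csM : closed_subalgebra M.
  split.
  - by move=> h [].
  - have c0 : continuous (cst 0 : Y -> R[i]^o) by move=> y; exact: cvg_cst.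
    split; [exact: c0|move=> h' [ch' Dh']; split; first exact: (cM _ _ c0 ch')].
    move=> k; rewrite (_ : T k _ = cst 0); first exact: us_cst.
    by apply/funext => y; rewrite /T big1 // => i _ /=; rewrite mul0r mulr0.
  - move=> f g [cf fD] [cg gD]; split=> [y|h' Dh'].
      by apply: cvgD; [exact: cf|exact: cg].
    have [c1 D1] := fD _ Dh'; have [c2 D2] := gD _ Dh'.
    have -> : (f \+ g) \* h' = (f \* h') \+ (g \* h').
      by apply/funext => y /=; rewrite mulrDl.
    split=> [y|k]; first by apply: cvgD; [exact: c1|exact: c2].
    rewrite (_ : T k _ = (fun y => T k (f \* h') y + T k (g \* h') y)); first exact: us_add.
    by apply/funext => y; rewrite /T -big_split; apply: eq_bigr => i _ /=; rewrite mulrDr.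
  - move=> c f [cf fD]; split=> [y|h' Dh']; first by apply: cvgM; [exact: cvg_cst|exact: cf].
    have [c1 D1] := fD _ Dh'.
    have -> : (fun x => c * f x) \* h' = (fun x => c * (f \* h') x).
      by apply/funext => y /=; rewrite mulrA.
    split=> [y|k]; first by apply: cvgM; [exact: cvg_cst|exact: c1].
    rewrite (_ : T k _ = (fun y => c * T k (f \* h') y)); first exact: us_scale.
    by apply/funext => y; rewrite /T mulr_sumr; apply: eq_bigr => i _ /=; rewrite mulrCA.
  - move=> f g [cf fD] [cg gD]; split=> [|h' Dh']; first exact: cM.
    have -> : (f \* g) \* h' = f \* (g \* h') by apply/funext => y /=; rewrite mulrA.
    by apply: fD; exact: gD.
  apply/closed_uniformP => g gP; split.
    by apply: continuous_uniform_limit => e /gP[h [ch _] gh]; exists h.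
  move=> h' Dh'; have [N' N'0 h'N] := compact_normc_bounded cY Dh'.1.
  apply: D_limit => e e0; have [|h [_ hD] gh] := gP (e / N'); first by rewrite divr_gt0.
  exists (h \* h'); first exact: hD.
  move=> y /=; rewrite -mulrBl normcM; have := gh y; rewrite ltr_pdivlMr //.
  by have := h'N y; have := normc_ge0 (g y - h y); nra.
have D1 : D (cst 1).
  split=> [y|k]; first exact: cvg_cst.
  rewrite (_ : T k _ = (fun y => \sum_i p (tau i y) ^+ k)).
    exact: sumB.
  by apply/funext => y; apply: eq_bigr => i _ /=; rewrite mulr1.
have sM : B `|` [set p] `<=` M.
  move=> g [tg|->].
    have cg := csa_continuous (us_subalgebra hB) tg.
    split; [exact: cg|move=> h' [ch' Dh']; split=> [|k]; first exact: (cM _ _ cg ch')].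
    rewrite (_ : T k _ = (fun y => g y * T k h' y)); first exact: us_mul.
    apply/funext => y; rewrite /T mulr_sumr; apply: eq_bigr => i _ /=.
    by rewrite (tauB i g y tg) mulrCA.
  split; [exact: cp|move=> h' [ch' Dh']; split=> [|k]; first exact: (cM _ _ cp ch')].
  rewrite (_ : T k _ = T k.+1 h') //.
  by apply/funext => y; apply: eq_bigr => i _ /=; rewrite exprSr mulrA.
have [_ /(_ _ D1)[_ /(_ 0%N)]] := hh0 _ (conj csM sM).
rewrite (_ : T _ _ = (fun y => \sum_i h0 (tau i y))) //.
by apply/funext => y; apply: eq_bigr => i _ /=; rewrite expr0 mul1r mulr1.
Qed.


End Adjunction.

(** * The sheets of a Cole extension *)

Section Roots.
Context {R : realType} {X : topologicalType}.
Implicit Types a : monic_poly R X.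

Definition poly_at a (x : X) : {poly R[i]} :=
  \poly_(j < (mdeg a).+1) (if insub (j : nat) is Some i then mcoef (i : 'I_(mdeg a)) x else 1).

Lemma coef_poly_at a x j : (poly_at a x)`_j =
  if insub j is Some i then mcoef (i : 'I_(mdeg a)) x else (j == mdeg a)%:R.
Proof.
rewrite coef_poly; case: insubP => [i im ij|]; first by rewrite ltnS ltnW.
by rewrite -leqNgt => mj; rewrite ltnS eqn_leq mj andbT; case: leqP.
Qed.

Lemma horner_poly_at a x z : (poly_at a x).[z] = meval a x z.
Proof.
rewrite horner_poly big_ord_recr /= insubF ?ltnn // mul1r; congr (_ + _).
apply: eq_bigr => i _; rewrite insubT //= => im; congr (mcoef _ _ * _).
exact: val_inj.
Qed.

Lemma poly_at_roots a x : exists r : 'I_(mdeg a) -> R[i]^o, root_prod r = poly_at a x.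
Proof.
have [s] := closed_field_poly_normal (poly_at a x).
have lc : (poly_at a x)`_(mdeg a) = 1 by rewrite coef_poly_at insubF ?ltnn // eqxx.
have sz : size (poly_at a x) = (mdeg a).+1.
  apply/eqP; rewrite eqn_leq size_poly /=; rewrite leqNgt; apply/negP => h.
  by move/eqP: lc; rewrite nth_default // eq_sym oner_eq0.
rewrite /lead_coef sz /= lc scale1r => pE.
have ss : size s = mdeg a.
  by have := sz; rewrite pE size_prod_XsubC => -[].
exists (fun i => s`_i); rewrite pE (big_nth 0) big_mkord ss.
by apply: eq_bigr.
Qed.

Definition roots_at a x : 'I_(mdeg a) -> R[i]^o := sval (cid (poly_at_roots a x)).
Arguments roots_at a x i : clear implicits.

Lemma roots_atE a x : root_prod (roots_at a x) = poly_at a x.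
Proof. by rewrite /roots_at; case: cid. Qed.

Lemma meval_roots_at a x i : meval a x (roots_at a x i) = 0.
Proof.
rewrite -horner_poly_at -roots_atE horner_prod (bigD1 i) //=.
by rewrite !hornerE subrr mul0r.
Qed.

Lemma meval_continuous a (t : R[i]^o) : (forall i, continuous (mcoef (m := a) i)) ->
  continuous (fun x => meval a x t).
Proof.
move=> ca x; apply: cvgD; last exact: cvg_cst.
apply: (@cvg_big (R[i]^o)) => [|i _]; first exact: add_continuous.
by apply: cvgM; [exact: ca|exact: cvg_cst].
Qed.

End Roots.
Arguments roots_at {R X} a x i.

Section ColeSpace.
Context {R : realType} {X : topologicalType} (U : set (monic_poly R X)).
Local Notation Y := (cole_space U).

Lemma cole_proj_continuous : continuous (cole_proj U).
Proof.
move=> y; apply: (@continuous_comp _ _ _ (fun q : Y => \val q) fst).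
  exact: initial_continuous.
exact: cvg_fst.
Qed.

Lemma cole_root_continuous (a : U) : continuous (cole_root a).
Proof.
move=> y; apply: (@continuous_comp _ _ _ (fun q : Y => (\val q).2) (fun l => l a)).
  apply: (@continuous_comp _ _ _ (fun q : Y => \val q) snd).
    exact: initial_continuous.
  exact: cvg_snd.
exact: (@proj_continuous {classic U} (fun=> R[i]^o) a).
Qed.

Lemma cole_space_ext (y y' : Y) : cole_proj U y = cole_proj U y' ->
  (forall a : U, cole_root a y = cole_root a y') -> y = y'.
Proof.
case: y y' => [[x l] yP] [[x' l'] yP']; rewrite /cole_proj /cole_root /= => xx' ll'.
by apply/val_inj => /=; rewrite xx'; congr (_, _); apply/funext => a; exact: ll'.
Qed.

Lemma cole_rootP (a : U) (y : Y) : meval (\val a) (cole_proj U y) (cole_root a y) = 0.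
Proof. by have := valP y; rewrite inE => /(_ a). Qed.

Lemma cole_update_ex (a : U) (y : Y) (z : R[i]^o) : exists y' : Y,
  [/\ cole_proj U y' = cole_proj U y,
      forall b, b <> a -> cole_root b y' = cole_root b y &
      meval (\val a) (cole_proj U y) z = 0 -> cole_root a y' = z].
Proof.
have [az|naz] := pselect (meval (\val a) (cole_proj U y) z = 0); last by exists y.
pose l : {ptws U -> R[i]^o} := fun b => if pselect (b = a) then z else cole_root b y.
have yl : (cole_proj U y, l) \in @cole_set R X U.
  rewrite inE => b; rewrite /l /=; case: pselect => [ba|_] /=; last exact: cole_rootP.
  by rewrite ba.
exists (SigSub yl); split => // [b ba|_]; rewrite /cole_root /= /l;
  by case: pselect.
Qed.

Definition cole_update a y z : Y := sval (cid (cole_update_ex a y z)).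

Lemma cole_update_proj a y z : cole_proj U (cole_update a y z) = cole_proj U y.
Proof. by rewrite /cole_update; case: cid => y' []. Qed.

Lemma cole_update_neq a y z b : b <> a ->
  cole_root b (cole_update a y z) = cole_root b y.
Proof. by move=> ba; rewrite /cole_update; case: cid => y' /= [_ /(_ _ ba)]. Qed.

Lemma cole_update_eq a y z : meval (\val a) (cole_proj U y) z = 0 ->
  cole_root a (cole_update a y z) = z.
Proof. by move=> az; rewrite /cole_update; case: cid => y' /= [_ _ /(_ az)]. Qed.

(** The points of the fibre obtained from [y] by moving its coordinate [a] through
    the roots, repeated according to their multiplicities.  The enumeration of
    the roots is not continuous in the base point in general. *)
Definition sheet a (i : 'I_(mdeg (\val a))) (y : Y) : Y :=
  cole_update a y (roots_at (\val a) (cole_proj U y) i).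

Lemma sheet_proj a i y : cole_proj U (sheet (a := a) i y) = cole_proj U y.
Proof. exact: cole_update_proj. Qed.

Lemma sheet_neq a i y b : b <> a -> cole_root b (sheet (a := a) i y) = cole_root b y.
Proof. exact: cole_update_neq. Qed.

Lemma sheet_eq a i y : cole_root a (sheet (a := a) i y) =
  roots_at (\val a) (cole_proj U y) i.
Proof. by apply: cole_update_eq; exact: meval_roots_at. Qed.

Lemma mdeg_gt0 (a : U) (y : Y) : (0 < mdeg (\val a))%N.
Proof.
have := cole_rootP a y; case: (\val a) => -[|n] c //=; rewrite /meval /=.
by rewrite big_ord0 add0r expr0 => /eqP; rewrite oner_eq0.
Qed.

(** The roots form a multiset that varies continuously.  Along an ultrafilter
    converging to [y0], each [sheet i] has a limit [z i] by compactness; the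
    limits [rho i] of the roots are the roots of the limit polynomial with the
    right multiplicities, because a product of monic linear factors determines
    its factors up to order. *)
Lemma sheet_sum_continuous (a : U) (h : Y -> R[i]^o) : hausdorff_space X ->
  compact [set: Y] -> (forall i, continuous (mcoef (m := \val a) i)) ->
  continuous h -> continuous (fun y => \sum_i h (sheet (a := a) i y)).
Proof.
move=> hX cY ca ch y0; apply: (ultra_cvg (nbhs_filter (y0 : Y))) => G GU Gy0.
have hC : hausdorff_space R[i]^o by exact: norm_hausdorff.
have cvgf (Z : topologicalType) (q : Y -> Z) : continuous q -> q @ G --> q y0.
  by move=> cq; apply: cvg_trans (cq y0); exact: (cvg_app _ Gy0).
have /choice[z zP] i := compact_ultra_map (sheet (a := a) i) cY GU.
have zq (Z : topologicalType) (q : Y -> Z) i :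
    continuous q -> (q \o sheet (a := a) i) @ G --> q (z i).
  by move=> cq; apply: (cvg_comp _ _ (zP i)); exact: cq.
have zproj i : cole_proj U (z i) = cole_proj U y0.
  apply: (cvg_unique hX (zq _ _ i cole_proj_continuous)).
  rewrite (_ : _ \o _ = cole_proj U); first exact: (cvgf _ _ cole_proj_continuous).
  by apply/funext => y; exact: sheet_proj.
have zneq i b : b <> a -> cole_root b (z i) = cole_root b y0.
  move=> ba; apply: (cvg_unique hC (zq _ _ i (@cole_root_continuous b))).
  rewrite (_ : _ \o _ = cole_root b); first exact: (cvgf _ _ (@cole_root_continuous b)).
  by apply/funext => y; exact: sheet_neq.
pose rho i := cole_root a (z i).
have rhoP i : roots_at (\val a) (cole_proj U y) i @[y --> G] --> rho i.
  have := zq _ _ i (@cole_root_continuous a).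
  rewrite (_ : _ \o _ = (fun y => roots_at (\val a) (cole_proj U y) i)) //.
  by apply/funext => y; exact: sheet_eq.
have rhoE : root_prod rho = root_prod (roots_at (\val a) (cole_proj U y0)).
  have ev t : (root_prod rho).[t] = (poly_at (\val a) (cole_proj U y0)).[t].
    have h1 : (root_prod (roots_at (\val a) (cole_proj U y))).[t] @[y --> G] -->
        ((root_prod rho).[t] : R[i]^o).
      rewrite horner_prod; under eq_cvg do rewrite horner_prod.
      apply: (@cvg_big (R[i]^o)) => [|i _]; first exact: mul_continuous.
      rewrite !hornerE; under eq_cvg do rewrite !hornerE.
      by apply: cvgB; [exact: cvg_cst|exact: rhoP].
    suff h2 : (root_prod (roots_at (\val a) (cole_proj U y))).[t] @[y --> G] -->
        ((poly_at (\val a) (cole_proj U y0)).[t] : R[i]^o).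
      exact: (cvg_unique hC h1 h2).
    rewrite horner_poly_at; under eq_cvg do rewrite roots_atE horner_poly_at.
    apply: (cvgf _ (fun y => meval (\val a) (cole_proj U y) t)) => y.
    apply: (@continuous_comp _ _ _ (cole_proj U) (fun x => meval (\val a) x t)).
      exact: cole_proj_continuous.
    exact: meval_continuous.
  rewrite roots_atE; apply/eqP; rewrite -subr_eq0; apply/eqP.
  set p := _ - _; apply: contrapT => /eqP p0.
  (* A polynomial that vanishes at all natural numbers is zero. *)
  have := @max_poly_roots _ p [seq (j%:R : R[i]) | j <- iota 0 (size p)] p0.
  rewrite size_map size_iota ltnn => H; suff : false by []. apply: H.
    by apply/allP => t _; rewrite rootE hornerD hornerN ev subrr.
  by rewrite map_inj_uniq ?iota_uniq // => i j /eqP; rewrite eqr_nat => /eqP.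
pose H t := h (cole_update a y0 t).
have hz i : h (z i) = H (rho i).
  congr h; apply: cole_space_ext => [|b]; first by rewrite zproj cole_update_proj.
  have [->|ba] := pselect (b = a); last by rewrite zneq // cole_update_neq.
  by rewrite cole_update_eq // -(zproj i); exact: cole_rootP.
have -> : \sum_i h (sheet (a := a) i y0) = \sum_i h (z i).
  under [RHS]eq_bigr do rewrite hz.
  have pe : perm_eq [seq rho i | i <- enum 'I_(mdeg (\val a))]
      [seq roots_at (\val a) (cole_proj U y0) i | i <- enum 'I_(mdeg (\val a))].
    apply: prod_XsubC_eq; rewrite !big_map -!enumT !big_enum; exact: rhoE.
  rewrite -[LHS]big_enum -[RHS]big_enum /=.
  by have := perm_big _ pe (op := +%R) (x := 0) (P := predT) (F := H);
     rewrite !big_map => ->.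
apply: (@cvg_big (R[i]^o)) => [|i _]; first exact: add_continuous.
exact: zq.
Qed.

End ColeSpace.

(** * Descent of logarithms along one Cole extension *)

Section ColeDescent.
Context {R : realType} {X : topologicalType} (U : set (monic_poly R X)).
Local Notation Y := (cole_space U).
Hypotheses (hX : hausdorff_space X) (cY : compact [set: Y]).
Hypothesis (proj_surj : forall x, exists y, cole_proj U y = x).

(** The roots are removed one at a time.  A step is void when the root belongs to
    the smaller algebra, and otherwise averages over the sheets of that root. *)
Lemma tower_log (B : seq U -> set (Y -> R[i]^o)) :
  (forall s, unital_subalgebra (B s)) -> (forall s, B [::] `<=` B s) ->
  (forall a s, B (a :: s) `<=` B s \/
    (forall i b y, B s b -> b (sheet (a := a) i y) = b y) /\
    (forall h, B (a :: s) h -> B s (fun y => \sum_i h (sheet (a := a) i y)))) ->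
  forall s f g, B [::] f -> B s g -> f = cexp \o g -> exponentials (B [::]) f.
Proof.
move=> hB B0 hS; elim=> [|a s IH] f g Bf Bg fE; first by exists g.
have [sB|[fixB sumB]] := hS a s; first by apply: (IH f g) => //; exact: sB.
have [g' Bg' g'E] := averaged_log cY (mdeg_gt0 a) (hB s) fixB sumB (B0 s _ Bf) Bg fE.
exact: (IH f g').
Qed.

Section ContinuousFunctions.

Definition agree (s : seq U) (y y' : Y) : Prop :=
  cole_proj U y = cole_proj U y' /\
  forall a, List.In a s -> cole_root a y = cole_root a y'.

(** On a fibre of the projection the values of [g] differ by periods of the
    exponential, so that an oscillation smaller than the periods vanishes. *)
Lemma agree_separates (f : X -> R[i]^o) (g : Y -> R[i]^o) : continuous g ->
  f \o cole_proj U = cexp \o g -> exists s, invariant_continuous (agree s) g.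
Proof.
move=> cg fE; have [c c0 cP] := @cexp_inj_near R.
have [||y y' yy'|s sP] := compact_directed_oscillation (E := agree) cY cg c0.
- exact: (inhabits [::]).
- move=> s s'; exists (s ++ s') => y y' [yy' h].
  by split; split=> // a a_s; apply: h; apply/List.in_or_app; [left|right].
- have [pp|pp] := pselect (cole_proj U y = cole_proj U y'); last first.
    exists [::], X, (cole_proj U); split=> //; first exact: cole_proj_continuous.
    by move=> z z' [].
  have [a aP] : exists a : U, cole_root a y <> cole_root a y'.
    by apply: contrapT => /forallNP h; apply: yy'; apply: cole_space_ext => // a;
      apply: contrapT; exact: h.
  exists [:: a], R[i]^o, (cole_root a); split; [exact: norm_hausdorff| |exact: aP|].
    exact: cole_root_continuous.
  by move=> z z' [_]; apply; left.
exists s; split=> // y y' yy'; apply: cP; first exact: sP.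
have := congr1 (fun k => k y) fE; have := congr1 (fun k => k y') fE.
by rewrite /= yy'.1 => <- <-.
Qed.

(** The algebras of the tower are those of the continuous functions of the base
    point and of finitely many coordinates. *)
Lemma cole_descent_continuous f :
  (forall a : U, forall i, continuous (mcoef (m := \val a) i)) ->
  continuous f ->
  exponentials (continuous_functions R Y) (f \o cole_proj U) ->
  exponentials (continuous_functions R X) f.
Proof.
move=> cU cf [g /= cg /esym fE]; have [s gs] := agree_separates cg fE.
have [||||h [ch hE] hfE] :=
  tower_log (B := fun s => invariant_continuous (agree s)) _ _ _ _ gs fE.
- move=> s'; exact: invariant_continuous_unital.
- by move=> s' h [ch hE]; split=> // y y' [yy' _]; apply: hE; split.
- move=> a s'; have [a_s|a_s] := pselect (List.In a s').
    left=> h [ch hE]; split=> // y y' [yy' h']; apply: hE; split=> // b [<-|]; exact: h'.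
  have nb b : List.In b s' -> b <> a by move=> bs ba; rewrite ba in bs.
  right; split=> [i b y [_ bE]|h [ch hE]].
    apply: bE; split; first exact: sheet_proj.
    by move=> b' /nb; exact: sheet_neq.
  split; first exact: (sheet_sum_continuous hX cY (cU a) ch).
  move=> y y' [yy' h']; apply: eq_bigr => i _; apply: hE; split.
    by rewrite !sheet_proj.
  move=> b [<-|bs]; first by rewrite !sheet_eq yy'.
  by have ba := nb _ bs; rewrite !sheet_neq //; exact: h'.
- split=> [y|y y' [yy' _]]; last by rewrite /= yy'.
  exact: (continuous_comp (@cole_proj_continuous _ _ U y) (cf _)).
have /choice[q qP] := proj_surj.
pose k x := h (q x).
have kE : k \o cole_proj U = h.
  by apply/funext => y; apply: hE; split => //; exact: qP.
exists k.
  apply: (continuous_factor cY hX (@cole_proj_continuous _ _ U) proj_surj).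
  by rewrite kE.
by apply/funext => x; have := congr1 (fun u => u (q x)) hfE; rewrite /= qP.
Qed.

End ContinuousFunctions.

Section UniformAlgebra.
Variable (A : set (X -> R[i]^o)).
Hypotheses (hA : unital_subalgebra A) (UA : U `<=` monic_over A).

Fixpoint generators (s : seq U) : set (Y -> R[i]^o) :=
  if s is a :: s' then generators s' `|` [set cole_root a]
  else [set f \o cole_proj U | f in A].

Definition tower s := smallest closed_subalgebra (generators s).

Lemma generators_continuous s g : generators s g -> continuous g.
Proof.
elim: s g => [g [f Af <-] y|a s IH g [|->]]; last 2 first.
- exact: IH.
- exact: cole_root_continuous.
apply: (@continuous_comp _ _ _ (cole_proj U) f); first exact: cole_proj_continuous.
exact: (csa_continuous (us_subalgebra hA)).
Qed.

Lemma generators_base s : generators [::] `<=` generators s.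
Proof. by elim: s => [//|a s IH] g /IH; left. Qed.

Lemma tower_unital s : unital_subalgebra (tower s).
Proof.
split; first exact: (smallest_subalgebra (@generators_continuous s)).
move=> c; apply: sub_gen_smallest; apply: generators_base.
by exists (cst c) => //; exact: us_cst.
Qed.

Lemma tower_root a s : tower (a :: s) (cole_root a).
Proof. by apply: sub_gen_smallest; right. Qed.

Lemma tower_sub s s' : generators s `<=` generators s' -> tower s `<=` tower s'.
Proof.
move=> gss'; apply: smallest_sub; first exact: us_subalgebra (tower_unital s').
by apply: subset_trans gss' _; exact: sub_gen_smallest.
Qed.

Lemma generators_catr s s' : generators s' `<=` generators (s ++ s').
Proof. by elim: s => [//|a s IH] g /IH; left. Qed.

Lemma generators_catl s s' : generators s `<=` generators (s ++ s').
Proof.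
elim: s => [|a s IH]; first exact: generators_base.
by move=> g [/IH|]; [left|right].
Qed.

Lemma tower_base_proj g : tower [::] g -> [set k \o cole_proj U | k in A] g.
Proof.
have [csA _] := pullback_unital (@cole_proj_continuous _ _ U) proj_surj hA.
by move=> /(_ _ (conj csA (@subset_refl _ _))).
Qed.

(** The towers are directed under concatenation of lists: their union is an
    algebra, and its closure contains the generators of the extension. *)
Lemma cole_algebra_tower g : cole_algebra U A g -> forall e : R, 0 < e ->
  exists s, exists2 h, tower s h & forall y, normc (g y - h y) < e.
Proof.
pose P : set (Y -> R[i]^o) := [set h | exists s, tower s h].
have dir h k : P h -> P k -> exists s, tower s h /\ tower s k.
  move=> [s hs] [s' ks']; exists (s ++ s'); split.
    exact: (tower_sub (@generators_catl s s')).
  exact: (tower_sub (@generators_catr s s')).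
have csP : closed_subalgebra (closure (P : set {uniform Y -> R[i]^o})).
  apply: closure_of_subalgebra => //.
  - by move=> f [s fs]; exact: (csa_continuous (us_subalgebra (tower_unital s))).
  - by exists [::]; exact: us_cst (tower_unital _) _.
  - move=> f h Pf Ph; have [s [fs hs]] := dir _ _ Pf Ph; exists s.
    exact: (csa_add (us_subalgebra (tower_unital s))).
  - move=> c f [s fs]; exists s; exact: (csa_scale (us_subalgebra (tower_unital s))).
  - move=> f h Pf Ph; have [s [fs hs]] := dir _ _ Pf Ph; exists s.
    exact: (csa_mul (us_subalgebra (tower_unital s))).
move=> gA e e0.
have /closure_uniformP/(_ _ e0)[h [s hs] gh] : closure (P : set {uniform Y -> R[i]^o}) g.
  apply: gA; split=> // f [Af|[a _ <-]]; apply: subset_closure.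
    by exists [::]; exact: sub_gen_smallest.
  by exists [:: a]; exact: tower_root.
by exists s, h.
Qed.

Lemma tower_sheet a s : ~ List.In a s -> forall i b y, tower s b ->
  b (sheet (a := a) i y) = b y.
Proof.
move=> a_s i b y sb.
suff : invariant_continuous (fun y y' => exists i, y = sheet (a := a) i y') b.
  by move=> [_]; apply; exists i.
apply: sb; split; first exact: us_subalgebra (invariant_continuous_unital _).
elim: s a_s => [_ g [f Af <-]|b' s IH a_s g [|->]].
- split=> [|y1 y2 [j ->]]; last by rewrite /= sheet_proj.
  by apply: (@generators_continuous [::]); exists f.
- by apply: IH => h; apply: a_s; right.
split=> [|y1 y2 [j ->]]; first exact: cole_root_continuous.
by apply: sheet_neq => e; apply: a_s; left.
Qed.

Lemma tower_root_in a s : List.In a s -> tower s (cole_root a).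
Proof.
move=> a_s; apply: sub_gen_smallest.
by elim: s a_s => //= b s IH [<-|/IH]; [right|left].
Qed.

Lemma tower_power_sum a s k :
  tower s (fun y => \sum_i cole_root a (sheet (a := a) i y) ^+ k).
Proof.
rewrite (_ : (fun _ => _) = (fun y => \sum_i roots_at (\val a) (cole_proj U y) i ^+ k)).
  apply: (us_power_sum (r := fun i y => roots_at (\val a) (cole_proj U y) i)).
    exact: tower_unital.
  move=> j; rewrite (_ : (fun _ => _) = (fun y => (poly_at (\val a) (cole_proj U y))`_j)).
    under [X in tower s X]funext do rewrite coef_poly_at.
    case: insubP => [i _ _|_]; last exact: us_cst (tower_unital s) _.
    apply: sub_gen_smallest; apply: generators_base.
    by exists (mcoef i) => //; apply: UA; exact: set_valP.
  by apply/funext => y; rewrite roots_atE.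
by apply/funext => y; apply: eq_bigr => i _; rewrite sheet_eq.
Qed.

Lemma tower_sheet_sum a s : ~ List.In a s -> forall h, tower (a :: s) h ->
  tower s (fun y => \sum_i h (sheet (a := a) i y)).
Proof.
move=> a_s h ah; apply: (sum_adjunction (p := cole_root a)) => //.
- exact: tower_unital.
- exact: cole_root_continuous.
- exact: tower_sheet.
- exact: tower_power_sum.
move=> M [hM sM]; apply: ah; split=> // g [gs|->]; apply: sM; last by right.
by left; exact: sub_gen_smallest.
Qed.

(** A logarithm in the whole extension is close to a finite stage of the tower,
    so it belongs to that stage by [us_log_near]; [tower_log] brings it down. *)
Lemma cole_descent f : A f -> exponentials (cole_algebra U A) (f \o cole_proj U) ->
  exponentials A f.
Proof.
move=> Af [g gA /esym fE]; have [c c0 cP] := us_log_near R.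
have [s [h hs gh]] := cole_algebra_tower gA c0.
have f0 : tower [::] (f \o cole_proj U) by apply: sub_gen_smallest; exists f.
have fs s' : tower [::] `<=` tower s' by apply: tower_sub; exact: generators_base.
have gs : tower s g := cP _ _ _ _ _ cY (tower_unital s) (fs s _ f0) fE hs gh.
have [|h' /tower_base_proj[k Ak <-] kE] := tower_log tower_unital fs _ f0 gs fE.
  move=> a s'; have [a_s|a_s] := pselect (List.In a s').
    left; apply: smallest_sub; first exact: us_subalgebra (tower_unital s').
    by move=> u [|->]; [exact: sub_gen_smallest|exact: tower_root_in].
  by right; split; [exact: tower_sheet|exact: tower_sheet_sum].
exists k => //; apply/funext => x; have [y <-] := proj_surj x.
exact: (congr1 (fun u => u y) kE).
Qed.

End UniformAlgebra.
End ColeDescent.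

(** * Descent of logarithms along a system *)

Section Systems.
Context {R : realType} {d : Order.disp_t} {I : tbOrderType d}.
Hypothesis I_wo : well_order (<=%O : rel I).
Variable Om : I -> topologicalType.
Variable A : forall t, set (Om t -> R[i]^o).
Arguments A : clear implicits.
Variable pi : forall s t : I, (s <= t)%O -> Om t -> Om s.
Hypothesis A_sys : cole_system A pi.

Lemma wo_induction (P : I -> Prop) :
  (forall t, (forall s, (s < t)%O -> P s) -> P t) -> forall t, P t.
Proof.
move=> H t; apply: contrapT => nPt.
have [|z [[zn zmin] _]] := I_wo (A := [pred x | `[< ~ P x >]]).
  by exists t; apply/asboolP.
have nPz : ~ P z by exact/asboolP.
apply: nPz; apply: H => s sz.
apply: contrapT => nPs; have : (z <= s)%O by apply: zmin; exact/asboolP.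
by rewrite leNgt sz.
Qed.

Lemma bot_succ_limit (t : I) : [\/ t = \bot%O, exists s, is_succ s t | is_limit t].
Proof.
have [->|t0] := eqVneq t \bot%O; first exact: Or31.
have [st|nst] := pselect (exists s, is_succ s t); first exact: Or32.
by apply: Or33; split; [rewrite lt0x|exact/forallNP].
Qed.

Lemma succ_le (s r t : I) : is_succ s t -> (r < t)%O -> (r <= s)%O.
Proof. by move=> [_ st] rt; rewrite leNgt; apply/negP => /st; rewrite leNgt rt. Qed.

Lemma Om_compact t : compact [set: Om t].
Proof. exact: ua_compact (cs_algebra A_sys t). Qed.

Lemma Om_hausdorff t : hausdorff_space (Om t).
Proof. exact: ua_hausdorff (cs_algebra A_sys t). Qed.

Lemma A_unital t : unital_subalgebra (A t).
Proof. exact: uniform_algebra_unital (cs_algebra A_sys t). Qed.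

Lemma pi_continuous s t (st : (s <= t)%O) : continuous (pi st).
Proof. exact: (cs_continuous A_sys). Qed.

Lemma pi_idE s (ss : (s <= s)%O) : pi ss = id.
Proof. by apply/funext => x; exact: (cs_id A_sys). Qed.

Lemma pi_compE r s t (rs : (r <= s)%O) (st : (s <= t)%O) (rt : (r <= t)%O) :
  pi rs \o pi st = pi rt.
Proof. by apply/funext => x; exact: (cs_comp A_sys). Qed.

Lemma A_pullback s t (st : (s <= t)%O) f : A s f -> A t (f \o pi st).
Proof.
elim/wo_induction: t s st f => t IH s st f Af.
have refl (e : s = t) : A t (f \o pi st).
  by subst t; rewrite pi_idE.
have [/refl//|nst] := eqVneq s t.
have s_t : (s < t)%O by rewrite lt_neqAle nst.
have [t0|[r rt]|lt] := bot_succ_limit t.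
- by have := s_t; rewrite {1}t0 ltx0.
- have sr := succ_le rt s_t; have r_t := ltW rt.1.
  have [U _ [h [_ hpi ->]]] := cs_succ A_sys (ltW rt.1) rt.
  exists ((f \o pi sr) \o cole_proj U).
    by apply: sub_gen_smallest; left; exists (f \o pi sr) => //; apply: IH Af; exact: rt.1.
  rewrite -(pi_compE sr (ltW rt.1) st); apply/funext => x /=.
  by rewrite hpi.
rewrite (cs_limit_algebra A_sys lt); apply: subset_closure.
exists (exist _ s s_t : {s : I | (s < t)%O}) => //; exists f => //.
by congr (f \o pi _); exact: bool_irrelevance.
Qed.

Section Successor.
Variables (s t : I) (st : (s <= t)%O) (sst : is_succ s t).

(** A successor step up to homeomorphism, in the form that serves for both
    families of algebras. *)
Lemma succ_cole : exists2 U : set (monic_poly R (Om s)), U `<=` monic_over (A s) &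
  exists (h : Om t -> cole_space U) (k : cole_space U -> Om t),
  [/\ compact [set: cole_space U], (forall x, exists y, cole_proj U y = x),
     continuous k, cancel k h &
     cole_proj U \o h = pi st /\ A t = [set f \o h | f in cole_algebra U (A s)]].
Proof.
have [U UA [h [[ch [k [ck hk kh]]] hpi AE]]] := cs_succ A_sys st sst.
exists U => //; exists h, k; split => //.
- have -> : [set: cole_space U] = h @` [set: Om t].
    by rewrite eqEsubset; split=> // y _; exists (k y).
  by apply: continuous_compact (@Om_compact t); exact: continuous_subspaceT.
- by move=> x; have [y <-] := cs_surjective A_sys st x; exists (h y).
by split=> //; apply/funext => x; exact: hpi.
Qed.

Lemma A_descent_succ f : A s f -> exponentials (A t) (f \o pi st) -> exponentials (A s) f.
Proof.
move=> Af; have [U UA [h [k [cY sY _ kh [<- ->]]]]] := succ_cole.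
move=> [_ [g gA <-] gE].
apply: (cole_descent cY sY (A_unital s) UA Af); exists g => //.
by apply/funext => z; rewrite -(kh z); exact: (congr1 (fun u => u (k z)) gE).
Qed.

Lemma continuous_descent_succ f : continuous f ->
  exponentials (continuous_functions R (Om t)) (f \o pi st) ->
  exponentials (continuous_functions R (Om s)) f.
Proof.
move=> cf; have [U UA [h [k [cY sY ck kh [<- _]]]]] := succ_cole.
move=> [g cg gE]; apply: (cole_descent_continuous (@Om_hausdorff s) cY sY) => //.
  move=> a i; apply: (csa_continuous (us_subalgebra (A_unital s))).
  by apply: UA; exact: set_valP.
exists (g \o k); first by move=> z; exact: (continuous_comp (ck z) (cg _)).
by apply/funext => z; have := congr1 (fun u => u (k z)) gE; rewrite /= kh.
Qed.

End Successor.

(** A logarithm in [A t] is close to a function pulled back from some [A s], hence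
    is itself pulled back from [A s], by [us_log_near]. *)
Lemma A_descent_limit (t : I) (lt : is_limit t) f : A \bot%O f ->
  exponentials (A t) (f \o pi (le0x t)) ->
  exists2 s, (s < t)%O & exponentials (A s) (f \o pi (le0x s)).
Proof.
move=> Af [g]; rewrite (cs_limit_algebra A_sys lt) => /closure_uniformP gA /esym gE.
have [c c0 cP] := us_log_near R.
have [_ [[s s_t] _ [k /= Ak <-]] gk] := gA _ c0.
exists s => //; move: (ltW _) gk => st gk.
have hB := pullback_unital (@pi_continuous _ _ st) (cs_surjective A_sys st) (A_unital s).
have [k' Ak' gE'] : [set h \o pi st | h in A s] g.
  apply: (cP _ _ (f \o pi (le0x t)) g (k \o pi st)) => //.
  - exact: Om_compact.
  - exists (f \o pi (le0x s)); first exact: A_pullback.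
    by rewrite -(pi_compE (le0x s) st (le0x t)).
  - by exists k.
exists k' => //; apply/funext => x; have [y <-] := cs_surjective A_sys st x.
have := congr1 (fun u => u y) gE; rewrite -(pi_compE (le0x s) st (le0x t)) -gE'.
by move=> /= ->.
Qed.

(** The earlier spaces separate the points of an inverse limit, so [g] almost
    factors through one of them; as it jumps by periods on the fibres, it does
    factor. *)
Lemma continuous_descent_limit (t : I) (lt : is_limit t) f :
  exponentials (continuous_functions R (Om t)) (f \o pi (le0x t)) ->
  exists2 s, (s < t)%O &
    exponentials (continuous_functions R (Om s)) (f \o pi (le0x s)).
Proof.
move=> [g cg gE]; have [c c0 cP] := @cexp_inj_near R.
pose J := {s : I | (s < t)%O}.
pose E (j : J) y y' := pi (ltW (svalP j)) y = pi (ltW (svalP j)) y'.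
have refine (j k : J) : (sval j <= sval k)%O -> forall y y', E k y y' -> E j y y'.
  move=> jk y y'; rewrite /E -(pi_compE jk (ltW (svalP k)) (ltW (svalP j))) /=.
  by move=> ->.
have [||y y' yy'|[s s_t] sP] := compact_directed_oscillation (E := E) (@Om_compact t) cg c0.
- exact: (inhabits (exist _ \bot%O lt.1 : J)).
- move=> j k; have [jk|kj] := leP (sval j) (sval k).
    by exists k => y y' h; split=> //; exact: refine h.
  by exists j => y y' h; split=> //; apply: refine h; exact: ltW.
- have [h [[ch [k [ck hk kh]]] hpi]] := cs_limit_space A_sys lt.
  have [s sP] : exists s : J, pi (ltW (svalP s)) y <> pi (ltW (svalP s)) y'.
    apply: contrapT => /forallNP H; apply: yy'; apply: (can_inj hk); apply/val_inj.
    by apply: functional_extensionality_dep => s; rewrite /= !hpi; apply: contrapT; exact: H.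
  exists s, (Om (sval s)), (pi (ltW (svalP s))).
  by split=> //; [exact: Om_hausdorff|exact: pi_continuous].
exists s => //; have st := ltW s_t.
have gE' y y' : pi st y = pi st y' -> g y = g y'.
  move=> yy'; apply: cP.
    by apply: sP; rewrite /E /= (bool_irrelevance (ltW _) st).
  have := congr1 (fun u => u y) gE; have := congr1 (fun u => u y') gE.
  by rewrite -(pi_compE (le0x s) st (le0x t)) /= yy' => -> ->.
have /choice[q qP] := cs_surjective A_sys st.
have gq : (g \o q) \o pi st = g by apply/funext => y /=; apply: gE'; rewrite qP.
exists (g \o q).
  apply: (continuous_factor (@Om_compact t) (@Om_hausdorff s) (@pi_continuous _ _ st)).
    exact: (cs_surjective A_sys st).
  by rewrite gq.
apply/funext => x; have := congr1 (fun u => u (q x)) gE.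
by rewrite -(pi_compE (le0x s) st (le0x t)) /= qP.
Qed.

(** The family [B] is a parameter in order to cover both the given algebras [A t]
    and the algebras of all continuous functions. *)
Lemma transfinite_descent (B : forall t, set (Om t -> R[i]^o)) :
  (forall s t (st : (s <= t)%O) f, B s f -> B t (f \o pi st)) ->
  (forall s t (st : (s <= t)%O) f, is_succ s t -> B s f ->
     exponentials (B t) (f \o pi st) -> exponentials (B s) f) ->
  (forall t f, is_limit t -> B \bot%O f -> exponentials (B t) (f \o pi (le0x t)) ->
     exists2 s, (s < t)%O & exponentials (B s) (f \o pi (le0x s))) ->
  forall t f, B \bot%O f -> exponentials (B t) (f \o pi (le0x t)) ->
    exponentials (B \bot%O) f.
Proof.
move=> Bpull Bsucc Blim; elim/wo_induction => t IH f Bf.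
have [t0|[s st]|lt] := bot_succ_limit t.
- by subst t; rewrite pi_idE.
- rewrite -(pi_compE (le0x s) (ltW st.1) (le0x t)) => h.
  by apply: (IH s st.1 f Bf); apply: Bsucc st (Bpull _ _ _ _ Bf) h.
by move=> /(Blim _ _ lt Bf)[s s_t]; exact: IH.
Qed.

Lemma A_descent t f : A \bot%O f -> exponentials (A t) (f \o pi (le0x t)) ->
  exponentials (A \bot%O) f.
Proof.
apply: transfinite_descent => [||t']; first exact: A_pullback.
  by move=> s t' st f' sst; exact: A_descent_succ.
by move=> f' lt; exact: A_descent_limit.
Qed.

Lemma continuous_descent t f : continuous f ->
  exponentials (continuous_functions R (Om t)) (f \o pi (le0x t)) ->
  exponentials (continuous_functions R (Om \bot%O)) f.
Proof.
apply: (@transfinite_descent (fun t => continuous_functions R (Om t))).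
- by move=> s t' st f' cf x; exact: (continuous_comp (@pi_continuous _ _ st x) (cf _)).
- by move=> s t' st f' sst cf; exact: continuous_descent_succ.
by move=> t' f' lt _; exact: continuous_descent_limit.
Qed.

End Systems.

(** * Integral cocycles and logarithms *)

Section Periods.
Context {R : realType}.

(** The number [2 pi i r], a period of the exponential when [r] is an integer. *)
Definition period (r : R) : R[i]^o := Complex 0 (2 * pi * r).

Lemma periodD r s : period (r + s) = period r + period s.
Proof. by apply/eqP; rewrite eq_complex /= addr0 mulrDr !eqxx. Qed.

Lemma period_inj : injective period.
Proof.
move=> r s [] /(mulfI _); apply.
by rewrite mulf_neq0 // ?pnatr_eq0 // gt_eqF // pi_gt0.
Qed.

Lemma cexp_period_int (r : R) (k : int) : cexp (period (r + k%:~R)) = cexp (period r).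
Proof. by rewrite periodD cexpD cexp_2pi mulr1. Qed.

Lemma cexp_eq_period (z : R[i]^o) r : cexp z = cexp (period r) ->
  exists k : int, z = period (r + k%:~R).
Proof.
move=> e; have [k kE] : exists k : int, z - period r = Complex 0 (2 * pi * k%:~R).
  by apply: cexp_eq1; rewrite cexpD e cexp_unit.
by exists k; rewrite periodD -[period k%:~R]kE addrC subrK.
Qed.

Lemma period_continuous {X : topologicalType} (h : X -> R) : continuous h ->
  continuous (fun x => period (h x)).
Proof.
move=> ch x; apply/cvg_normcP => e e0.
have p0 : 0 < 2 * pi :> R by rewrite mulr_gt0 // pi_gt0.
have /cvgrPdist_lt/(_ (e / (2 * pi))) := ch x.
rewrite divr_gt0 // => /(_ isT); apply: filterS => y hy.
rewrite (_ : _ - _ = Complex 0 (2 * pi * (h x - h y))); last first.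
  by apply/eqP; rewrite eq_complex /= oppr0 addr0 mulrBr !eqxx.
rewrite /= expr0n add0r sqrtr_sqr normrM gtr0_norm //.
by rewrite mulrC -ltr_pdivlMr.
Qed.

End Periods.

(** Bump functions exist by complete regularity; finitely many of them have no
    common zero, and they are divided by their sum. *)
Lemma partition_of_unity (R : realType) (X : topologicalType) (V : set (set X)) :
  compact [set: X] -> hausdorff_space X -> open_cover V ->
  exists (J : finType) (v : J -> set X) (rho : J -> X -> R),
  [/\ forall j, V (v j), forall j, continuous (rho j),
      forall j x, rho j x != 0 -> v j x & forall x, \sum_j rho j x = 1].
Proof.
move=> cX hX [oV cV].
have cr := @normal_completely_regular R X (compact_normal hX cX) (hausdorff_accessible hX).
have /choice[p pP] (x : X) : exists p : set X * (X -> R), [/\ V p.1, continuous p.2,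
    forall y, 0 <= p.2 y, 0 < p.2 x & forall y, p.2 y != 0 -> p.1 y].
  have [v Vv vx] := cV x.
  have /(@uniform_separatorP _ R)[f [cf f01 fx fv]] : uniform_separator [set x] (~` v).
    by apply: cr; [exact/open_closedC/oV|exact].
  exists (v, fun y => 1 - f y) => /=; split=> //.
  - by move=> y; apply: cvgB; [exact: cvg_cst|exact: cf].
  - move=> y; have := f01 (f y) (ex_intro2 _ _ y I erefl).
    by rewrite /= in_itv /= subr_ge0 => /andP[].
  - by rewrite (_ : f x = 0) ?subr0 //; apply: fx; exists x.
  - move=> y; apply: contraPP => nvy; apply/negP; rewrite negbK; apply/eqP.
    by rewrite (_ : f y = 1) ?subrr //; apply: fv; exists y.
(* The bumps of a sufficiently large finite list of points cover [X]. *)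
pose F := filter_from [set: seq X] (fun s => [set s' : seq X | {subset s <= s'}]).
have FF : Filter F.
  apply: filter_from_filter; first by exists [::].
  move=> s1 s2 _ _; exists (s1 ++ s2) => // s' h; split=> x xs; apply: h.
    by rewrite mem_cat xs.
  by rewrite mem_cat xs orbT.
have [s _ sF] : \forall s \near F, [set: X] `<=` [set y | exists2 x, x \in s & 0 < (p x).2 y].
  move/compact_near_coveringP: cX; apply => // x _.
  have [_ cf _ fx _] := pP x.
  exists ([set y | 0 < (p x).2 y], [set s : seq X | x \in s]) => /=;
    last by move=> [y s] [/= ? ?]; exists x.
  split; last by exists [:: x] => // s; apply; rewrite inE.
  by have /cvgr_gt := cf x; apply.
have {sF} scov y : exists2 x, x \in s & 0 < (p x).2 y by exact: (sF s).
pose S y := \sum_(j : seq_sub s) (p (ssval j)).2 y.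
have S0 y : 0 < S y.
  have [x xs xy] := scov y.
  rewrite /S (bigD1 (SeqSub xs)) //= ltr_pwDl // sumr_ge0 // => j _.
  by have [_ _ + _ _] := pP (ssval j); exact.
exists (seq_sub s), (fun j => (p (ssval j)).1), (fun j y => (p (ssval j)).2 y / S y); split.
- by move=> j; have [] := pP (ssval j).
- move=> j y; apply: cvgM; first by have [_ + _ _ _] := pP (ssval j); exact.
  apply: cvgV; first by rewrite gt_eqF.
  apply: (@cvg_big R) => [|i _]; first exact: add_continuous.
  by have [_ + _ _ _] := pP (ssval i); exact.
- move=> j x; rewrite mulf_eq0 negb_or => /andP[h _].
  by have [_ _ _ _ +] := pP (ssval j); exact.
by move=> x; rewrite -mulr_suml -/(S x) divff // gt_eqF.
Qed.

Lemma glue_continuous (X Z : topologicalType) (W : set (set X)) (F : set X -> X -> Z) :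
  open_cover W -> (forall w, W w -> continuous (F w)) ->
  (forall u v x, W u -> W v -> u x -> v x -> F u x = F v x) ->
  exists2 f : X -> Z, continuous f & forall w x, W w -> w x -> f x = F w x.
Proof.
move=> [oW cW] cF FE.
have /choice[w wP] (x : X) : exists w, W w /\ w x by have [w] := cW x; exists w.
have fE v x : W v -> v x -> F (w x) x = F v x.
  by move=> Wv vx; have [Ww wx] := wP x; exact: FE.
exists (fun x => F (w x) x) => // x; have [Ww wx] := wP x.
have : F (w x) @ x --> F (w x) x by exact: cF.
apply: cvg_trans; apply: near_eq_cvg.
have : nbhs x (w x) by apply: open_nbhs_nbhs; split=> //; exact: oW.
by apply: filterS => y wy; rewrite (fE (w x)).
Qed.

(** Averaging against a partition of unity makes every cocycle with real
    coefficients a coboundary. *)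
Lemma cocycle_primitive (R : realType) (X : topologicalType) (V : set (set X)) c :
  compact [set: X] -> hausdorff_space X -> open_cover V -> cocycle V c ->
  exists2 h : set X -> X -> R, forall v, continuous (h v) &
    forall u v x, V u -> V v -> u x -> v x -> h v x = h u x + (c u v)%:~R.
Proof.
move=> cX hX oV cocV.
have [J [v [rho [Vv crho rho0 rho1]]]] := @partition_of_unity R X V cX hX oV.
exists (fun u x => - \sum_j (c u (v j))%:~R * rho j x).
  move=> u x; apply: cvgN; apply: (@cvg_big R) => [|j _]; first exact: add_continuous.
  by apply: cvgM; [exact: cvg_cst|exact: crho].
move=> u u' x Vu Vu' ux u'x.
suff -> : \sum_j (c u (v j))%:~R * rho j x =
    \sum_j (c u' (v j))%:~R * rho j x + (c u u')%:~R by rewrite opprD subrK.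
have -> : (c u u')%:~R = \sum_j (c u u')%:~R * rho j x.
  by rewrite -mulr_sumr rho1 mulr1.
rewrite -big_split /=.
apply: eq_bigr => j _; have [->|/rho0 vx] := eqVneq (rho j x) 0.
  by rewrite !mulr0 addr0.
have := cocV _ _ _ Vu Vu' (Vv j) (ex_intro _ x (conj (conj ux u'x) vx)).
move/(congr1 (fun k : int => k%:~R : R)); rewrite rmorphD rmorphB rmorph0 /= => e.
by rewrite -mulrDl; congr (_ * _); lra.
Qed.

Section CechDescent.
Context {R : realType} {X Y : topologicalType} (q : Y -> X).
Hypotheses (cX : compact [set: X]) (hX : hausdorff_space X).
Hypothesis (cq : continuous q).
Hypothesis sq : forall x, exists y, q y = x.

Lemma cexp_period_continuous (Z : topologicalType) (h : Z -> R) :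
  compact [set: Z] -> continuous h -> continuous (fun z => cexp (period (h z))).
Proof.
move=> cZ ch; have := us_cexp (@continuous_functions_unital R Z) cZ; apply.
exact: period_continuous.
Qed.

(** A class of [X] gives a nonvanishing function [f] whose logarithms correspond
    to the trivializations of that class.  As the pulled back class is trivial,
    [f \o q] has a logarithm; the hypothesis of descent gives one to [f]. *)
Lemma cech_H1_descent :
  (forall f, continuous f -> exponentials (continuous_functions R Y) (f \o q) ->
    exponentials (continuous_functions R X) f) ->
  (forall c : cech_H1 Y, c = 0) -> forall c : cech_H1 X, c = 0.
Proof.
move=> desc Y0 a; rewrite -(cech_classK a); move: (repr a) => {a} [V c oV cV].
have [h ch hE] := @cocycle_primitive R X V c cX hX oV cV.
(* The [h v] differ by integers where they overlap, so that their exponentials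
   agree there. *)
have [|u v x Vu Vv ux vx|f cf fE] :=
    @glue_continuous X (R[i]^o) V (fun v x => cexp (period (h v x))) oV.
- by move=> v _; exact: cexp_period_continuous.
- by rewrite (hE u v x) // cexp_period_int.
have preK v : q @` (q @^-1` v) = v.
  by rewrite image_preimage // eqEsubset; split=> // x _; have [y <-] := sq x; exists y.
have [g /= cg gE] : exponentials (continuous_functions R X) f.
  apply: desc => //.
  (* As [q] is surjective, images recover the members of the cover from their
     preimages. *)
  pose V' := [set q @^-1` v | v in V].
  pose c' u v := c (q @` u) (q @` v).
  have oV' : open_cover V'.
    split=> [_ [v Vv <-]|y]; first by move/continuousP: cq; apply; exact: oV.1.
    by have [v Vv vy] := oV.2 (q y); exists (q @^-1` v) => //; exists v.
  have cV' : cocycle V' c'.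
    move=> _ _ _ [u Vu <-] [v Vv <-] [w Vw <-] [y [[uy vy] wy]].
    by rewrite /c' !preK; apply: cV => //; exists (q y).
  have /cech_classP[W [r [s [oW rP _ [b bP]]]]] :
    cech_class (CechCocycle oV' cV') = cech_class (cocycle_zero Y) by exact: Y0.
  have Vr w : W w -> V (q @` (r w)) by move=> /rP[[v Vv <-] _]; rewrite preK.
  have rq w y : W w -> w y -> (q @` (r w)) (q y).
    by move=> /rP[_ +] wy => /(_ y wy) ry; exists y.
  (* The cochain [b] trivializes the pulled back cocycle: the differences of
     the [h v] and of [b] agree on overlaps. *)
  have [|u v y Wu Wv uy vy|g cg gE] := @glue_continuous Y (R[i]^o) W
      (fun w y => period (h (q @` (r w)) (q y) - (b w)%:~R)) oW.
  - move=> w _; apply: period_continuous => y; apply: cvgB; last exact: cvg_cst.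
    by apply: (@continuous_comp _ _ _ q (h (q @` r w))); [exact: cq|exact: ch].
  - have := bP u v Wu Wv (ex_intro _ y (conj uy vy)).
    rewrite cochain_addE cochain_oppE /pull /= cochain_zeroE subr0 /c' => e.
    rewrite (hE (q @` (r u)) (q @` (r v))) //; [|exact: Vr|exact: Vr|exact: rq|exact: rq].
    by rewrite e rmorphB /=; congr period; ring.
  exists g => //; apply/funext => y /=; have [w Ww wy] := oW.2 y.
  rewrite (gE w) // -rmorphN cexp_period_int (fE (q @` (r w))) //; first exact: Vr.
  exact: rq.
(* On [piece v k] the logarithm [g] exceeds [2 pi i h v] by the constant
   [2 pi i k].  These pieces are open, refine the cover, and the cochain [- k]
   on them has the given cocycle as coboundary. *)
pose piece (v : set X) (k : int) := v `&` [set x | g x = period (h v x + k%:~R)].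
pose W := [set w | exists v k, V v /\ w = piece v k].
have gh v x : V v -> v x -> cexp (g x) = cexp (period (h v x)).
  by move=> Vv vx; rewrite -(fE v) // -gE.
have oW : open_cover W.
  split=> [_ [v [k [Vv ->]]]|x]; last first.
    have [v Vv vx] := oV.2 x; have [k kE] := cexp_eq_period (gh _ _ Vv vx).
    by exists (piece v k) => //; exists v, k.
  have [d d0 dP] := @cexp_inj_near R.
  rewrite openE => x [vx gx].
  have c1 : continuous (fun y => period (h v y + k%:~R) - g y).
    move=> y; apply: cvgB; last exact: cg.
    apply: (@period_continuous R X (fun y => h v y + k%:~R)) => z.
    by apply: cvgD; [exact: ch|exact: cvg_cst].
  have n1 : nbhs x v by apply: open_nbhs_nbhs; split=> //; exact: oV.1.
  have /cvg_normcP/(_ _ d0) n2 := c1 x.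
  rewrite /interior; apply: filterS (filterI n1 n2) => y [vy /=].
  rewrite gx subrr sub0r normcN => dy; split=> //=; apply/esym/dP => //.
  by rewrite cexp_period_int -gh.
have /choice[p pP] (w : set X) : exists p : set X * int,
    W w -> V p.1 /\ w = piece p.1 p.2.
  have [[v [k [Vv ->]]]|nW] := pselect (W w); last by exists (set0, 0).
  by exists (v, k).
apply/cech_classP; exists W, (fun w => (p w).1), (fun=> setT); split => //=.
- by move=> w /pP[Vw wE]; split=> //; rewrite [X in X `<=` _]wE => x [].
exists (fun w => - (p w).2) => u v Wu Wv [x [ux vx]].
have [Vu uE] := pP _ Wu; have [Vv vE] := pP _ Wv.
rewrite {}uE in ux; rewrite {}vE in vx; case: ux vx => ux gu [vx gv].
rewrite cochain_addE cochain_oppE /pull /= cochain_zeroE subr0.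
have e := hE _ _ x Vu Vv ux vx.
have : h (p u).1 x + (p u).2%:~R = h (p v).1 x + (p v).2%:~R.
  by apply: period_inj; rewrite -gu -gv.
move=> e2; apply: (@intr_inj R); rewrite rmorphB !rmorphN /=; lra.
Qed.

End CechDescent.

Theorem corollary3p2p3p5 (R : realType) (d : Order.disp_t) (I : tbOrderType d)
    (I_wo : well_order (<=%O : rel I))
    (Om : I -> topologicalType)
    (A : forall t : I, set (Om t -> R[i]^o))
    (pi : forall s t : I, (s <= t)%O -> Om t -> Om s)
    (A_sys : cole_system A pi)
    (A_nat : forall t : I, natural (A t))
    (t : I) :
  [set f \o pi \bot%O t (le0x t)
    | f in invertibles (A \bot%O) `\` exponentials (A \bot%O)]
    `<=` invertibles (A t) `\` exponentials (A t)
  /\ ((forall c : cech_H1 (Om t), c = 0) ->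
      (forall c : cech_H1 (Om \bot%O), c = 0)).
Proof.
split.
  move=> _ [f [[Af [g Ag fg]] nexp] <-]; split.
    split; first exact: (A_pullback I_wo A_sys).
    exists (g \o pi _ _ (le0x t)); first exact: (A_pullback I_wo A_sys).
    by apply/funext => x; exact: (congr1 (fun u => u (pi _ _ (le0x t) x)) fg).
  by move=> /(A_descent I_wo A_sys Af).
apply: (@cech_H1_descent R _ _ (pi _ _ (le0x t))).
- exact: (Om_compact A_sys).
- exact: (Om_hausdorff A_sys).
- exact: (pi_continuous A_sys).
- exact: (cs_surjective A_sys).
by move=> f; exact: (continuous_descent I_wo A_sys).
Qed.
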